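(* Let $n\ge 1$, $I_1=(1,\dots,1)\in\mathbb{C}^n$, $f(z)=e^{z\cdot I_1}$, and let $g\in H(\mathbb{C}^n)\cap\mathrm{Sym}(\mathbb{C}^n)$. Suppose that $u\in L^2(\mathbb{C}^n,d\mu)$ is a solution of $\mathcal{B}[u]=f\overline{g}$ on $\mathbb{C}^n$. Then $$u(z)=e^{z\cdot I_1}\,\overline{g(z-I_1)}$$ for (almost every) $z\in\mathbb{C}^n$.
   Context: $dV$ is Lebesgue measure on $\mathbb{C}^n$ and $d\mu(z)=\pi^{-n}e^{-|z|^2}dV(z)$. For $z,w\in\mathbb{C}^n$, $z\cdot w=\sum_k z_kw_k$ (bilinear) and $|z|^2=z\cdot\overline{z}$. $H(\mathbb{C}^n)$ is the space of entire functions. $\mathrm{Sym}(\mathbb{C}^n)$ is the set of complex measurable functions $u$ such that for every $c>0$ the function $u(z)e^{-c|z|^2}$ is essentially bounded. Berezin transform: $K(w,z)=e^{w\cdot\overline{z}}$, $k(w,z)=K(w,z)/\sqrt{K(z,z)}$, and $\mathcal{B}[u](z)=\int_{\mathbb{C}^n}u(w)|k(w,z)|^2\,d\mu(w)$. *)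

(* Defs.v *)
From HB Require Import structures.
From mathcomp Require Import all_boot all_order all_algebra.
From mathcomp Require Import all_classical all_reals all_analysis.
From mathcomp Require Import measurable_realfun.
From mathcomp Require Import complex.

Set Implicit Arguments.
Unset Strict Implicit.
Unset Printing Implicit Defensive.

Import Order.TTheory GRing.Theory Num.Theory.
Import numFieldNormedType.Exports.

Local Open Scope classical_set_scope.
Local Open Scope ring_scope.
Local Open Scope complex_scope.

HB.instance Definition _ (R : realType) := PseudoPointedMetric.copy R[i] R[i]^o.
HB.instance Definition _ (R : realType) := NormedModule.copy R[i] R[i]^o.

(* The coordinate sigma-algebras below are the Borel sigma-algebras of
   C = R^2 and C^n. *)

Definition complex_display : measure_display.
Proof. exact: default_measure_display. Qed.

Section measurable_complex.
Variable R : realType.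

Definition complex_coord (z : R[i]) : measurableTypeR R * measurableTypeR R :=
  (complex.Re z, complex.Im z).

Definition complex_measurable : set (set R[i]) :=
  g_sigma_algebra_preimage complex_coord.

Let complex_measurable_sigma : sigma_algebra setT complex_measurable.
Proof. exact/sigma_algebra_preimage/sigma_algebra_measurable. Qed.

Let complex_measurable0 : complex_measurable set0.
Proof. by case: complex_measurable_sigma. Qed.

Let complex_measurableC A : complex_measurable A -> complex_measurable (~` A).
Proof. by case: complex_measurable_sigma => _ + _; rewrite -setTD; exact. Qed.

Let complex_measurableU (F : (set R[i])^nat) :
  (forall i, complex_measurable (F i)) -> complex_measurable (\bigcup_i F i).
Proof. by case: complex_measurable_sigma => _ _; exact. Qed.

HB.instance Definition _ := @isMeasurable.Build complex_display R[i]
  complex_measurable complex_measurable0 complex_measurableC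
  complex_measurableU.

End measurable_complex.

Definition rV_display : measure_display -> measure_display.
Proof. exact. Qed.

Section measurable_rV.
Context d (T : sigmaRingType d) (n : nat).

Definition rV_measurable : set (set 'rV[T]_n) :=
  g_sigma_preimage (fun (i : 'I_n) (v : 'rV[T]_n) => v ord0 i).

Let rV_measurable0 : rV_measurable set0.
Proof. exact: sigma_algebra0. Qed.

Let rV_measurableC A : rV_measurable A -> rV_measurable (~` A).
Proof. exact: sigma_algebraC. Qed.

Let rV_measurableU (F : (set 'rV[T]_n)^nat) :
  (forall i, rV_measurable (F i)) -> rV_measurable (\bigcup_i F i).
Proof. exact: sigma_algebra_bigcup. Qed.

HB.instance Definition _ := @isMeasurable.Build (rV_display d) 'rV[T]_n
  rV_measurable rV_measurable0 rV_measurableC rV_measurableU.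

End measurable_rV.

Lemma measurable_complex_coord (R : realType) :
  measurable_fun setT (@complex_coord R).
Proof. by move=> _ A mA; exists A. Qed.

Lemma measurable_Re (R : realType) :
  measurable_fun setT (fun z : R[i] => complex.Re z : measurableTypeR R).
Proof. exact: (measurableT_comp measurable_fst (@measurable_complex_coord R)). Qed.

Lemma measurable_Im (R : realType) :
  measurable_fun setT (fun z : R[i] => complex.Im z : measurableTypeR R).
Proof. exact: (measurableT_comp measurable_snd (@measurable_complex_coord R)). Qed.

Definition complex_of_pair (R : realType)
  (p : measurableTypeR R * measurableTypeR R) : R[i] := p.1 +i* p.2.

Lemma measurable_complex_of_pair (R : realType) :
  measurable_fun setT (@complex_of_pair R).
Proof.
move=> _ _ [B mB <-]; rewrite !setTI.
by rewrite (_ : _ @^-1` _ = B)//; apply/seteqP; split=> -[].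
Qed.

Lemma measurable_rV_coord d (T : sigmaRingType d) n (i : 'I_n) :
  measurable_fun setT (fun v : 'rV[T]_n => v ord0 i).
Proof.
move=> _ Y mY; rewrite setTI; apply: sub_sigma_algebra => /=.
rewrite -bigcup_seq/=; exists i => /=; first by rewrite mem_index_enum.
by exists Y => //; rewrite setTI.
Qed.

Lemma measurable_fun_rV d d' (T : measurableType d) (T' : measurableType d') n
    (f : T -> 'rV[T']_n) :
  (forall i, measurable_fun setT (fun x => f x ord0 i)) ->
  measurable_fun setT f.
Proof.
move=> mf _ A mA.
suff: @rV_measurable _ T' n `<=` image_set_system setT f measurable by exact.
apply: smallest_sub.
  exact/sigma_algebra_image/sigma_algebra_measurable.
rewrite -bigcup_seq => B [i _ [C mC <-]]; rewrite /image_set_system /=.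
by rewrite !setTI -[X in measurable X]setTI; exact: mf.
Qed.

(* The library's canonical sigma-finite instance on [m1 \x m2] is the one for
   finite factors, so sigma-finiteness is carried by explicit lemmas here. *)
Lemma product_measure_sigma_finite d1 d2 (T1 : measurableType d1)
    (T2 : measurableType d2) (R : realType)
    (m1 : {sigma_finite_measure set T1 -> \bar R})
    (m2 : {sigma_finite_measure set T2 -> \bar R}) :
  sigma_finite setT (m1 \x m2)%E.
Proof.
have /sigma_finiteP[F [TF ndF Foo]] := sigma_finiteT m1.
have /sigma_finiteP[G [TG ndG Goo]] := sigma_finiteT m2.
exists (fun n => F n `*` G n).
 rewrite -setXTT TF TG predeqE => -[x y]; split.
    move=> [/= [n _ Fnx] [k _ Gky]]; exists (maxn n k) => //; split.
    - by move: x Fnx; exact/subsetPset/ndF/leq_maxl.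
    - by move: y Gky; exact/subsetPset/ndG/leq_maxr.
  by move=> [n _ []/= ? ?]; split; exists n.
move=> k; have [? ?] := Foo k; have [? ?] := Goo k.
split; first exact: measurableX.
by rewrite product_measure1E// lte_mul_pinfty// ge0_fin_numE.
Qed.

Lemma pushforward_sigma_finite d d' (T : measurableType d)
    (T' : measurableType d') (R : realType) (mu : set T -> \bar R)
    (f : T -> T') (g : T' -> T) : measurable_fun setT g -> cancel f g ->
  sigma_finite setT mu -> sigma_finite setT (pushforward mu f).
Proof.
move=> mg fK [F UF mF]; exists (fun k => g @^-1` F k).
  by rewrite -preimage_bigcup -UF preimage_setT.
move=> k; have [mFk Fk] := mF k; split.
  by rewrite -[X in measurable X]setTI; exact: mg.
rewrite /pushforward (_ : _ @^-1` _ = F k)//.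
by apply/seteqP; split=> x /=; rewrite fK.
Qed.

Section lebesgue_complex.
Local Open Scope ereal_scope.
Variable R : realType.

HB.instance Definition _ := isMeasurableFun.Build _ _ _ _
  (@complex_of_pair R) (@measurable_complex_of_pair R).

Definition lebesgue_complex : set R[i] -> \bar R :=
  pushforward (lebesgue_measure \x lebesgue_measure) (@complex_of_pair R).

Let lebesgue_complex0 : lebesgue_complex set0 = 0.
Proof. exact: measure0. Qed.

Let lebesgue_complex_ge0 A : 0 <= lebesgue_complex A.
Proof. exact: measure_ge0. Qed.

Let lebesgue_complex_sigma_additive : semi_sigma_additive lebesgue_complex.
Proof. exact: measure_semi_sigma_additive. Qed.

HB.instance Definition _ := isMeasure.Build _ _ _ lebesgue_complex
  lebesgue_complex0 lebesgue_complex_ge0 lebesgue_complex_sigma_additive.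

Let lebesgue_complex_sigma_finite : sigma_finite setT lebesgue_complex.
Proof.
apply: (pushforward_sigma_finite (@measurable_complex_coord R)); first by case.
exact: product_measure_sigma_finite.
Qed.

HB.instance Definition _ := Measure_isSigmaFinite.Build _ _ _ lebesgue_complex
  lebesgue_complex_sigma_finite.

End lebesgue_complex.

Section cons_rV.
Context d (T : measurableType d) (n : nat).

Definition cons_rV (p : T * 'rV[T]_n) : 'rV[T]_n.+1 :=
  row_mx (\row_(_ < 1) p.1) p.2 : 'rV[T]_(1 + n).

Lemma measurable_cons_rV : measurable_fun setT cons_rV.
Proof.
apply: measurable_fun_rV => i.
case: (split_ordP (i : 'I_(1 + n)%N)) => j ->.
  rewrite (_ : (fun _ => _) = fst); first exact: measurable_fst.
  by apply/funext => p; rewrite /cons_rV (@row_mxEl _ 1 1 n) mxE.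
rewrite (_ : (fun _ => _) = (fun v : 'rV[T]_n => v ord0 j) \o snd).
  exact: (measurableT_comp (@measurable_rV_coord _ _ _ j) measurable_snd).
by apply/funext => p; rewrite /cons_rV (@row_mxEr _ 1 1 n).
Qed.

HB.instance Definition _ :=
  isMeasurableFun.Build _ _ _ _ cons_rV measurable_cons_rV.

Definition uncons_rV (v : 'rV[T]_n.+1) : T * 'rV[T]_n :=
  (v ord0 ord0, rsubmx (v : 'rV[T]_(1 + n))).

Lemma measurable_uncons_rV : measurable_fun setT uncons_rV.
Proof.
apply/measurable_fun_pairP; split => /=; first exact: measurable_rV_coord.
apply: measurable_fun_rV => i /=.
under eq_fun do rewrite mxE; exact: measurable_rV_coord.
Qed.

Lemma cons_rVK : cancel cons_rV uncons_rV.
Proof.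
move=> [x v]; rewrite /uncons_rV /cons_rV /= row_mxKr; congr pair.
by rewrite mxE; case: splitP => // j _; rewrite mxE.
Qed.

Context (R : realType).
Variables (m1 : {sigma_finite_measure set T -> \bar R}).
Variables (m2 : {sigma_finite_measure set 'rV[T]_n -> \bar R}).
Local Open Scope ereal_scope.

Definition cons_measure : set 'rV[T]_n.+1 -> \bar R :=
  pushforward (m1 \x m2) cons_rV.

Let cons_measure0 : cons_measure set0 = 0.
Proof. exact: measure0. Qed.

Let cons_measure_ge0 A : 0 <= cons_measure A.
Proof. exact: measure_ge0. Qed.

Let cons_measure_sigma_additive : semi_sigma_additive cons_measure.
Proof. exact: measure_semi_sigma_additive. Qed.

HB.instance Definition _ := isMeasure.Build _ _ _ cons_measure
  cons_measure0 cons_measure_ge0 cons_measure_sigma_additive.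

Let cons_measure_sigma_finite : sigma_finite setT cons_measure.
Proof.
apply: (pushforward_sigma_finite measurable_uncons_rV cons_rVK).
exact: product_measure_sigma_finite.
Qed.

HB.instance Definition _ := Measure_isSigmaFinite.Build _ _ _ cons_measure
  cons_measure_sigma_finite.

End cons_rV.

(* The n-fold product of lebesgue_complex; 'rV_0 is a point, of mass 1. *)
Fixpoint lebesgue_Cn (R : realType) (n : nat) :
    {sigma_finite_measure set 'rV[R[i]]_n -> \bar R} :=
  match n with
  | 0%N => dirac (0 : 'rV[R[i]]_0)
  | m.+1 => cons_measure (@lebesgue_complex R) (lebesgue_Cn R m)
  end.

Section complex_functions.
Variable R : realType.

Definition cexp (z : R[i]) : R[i] :=
  (expR (complex.Re z))%:C * (cos (complex.Im z) +i* sin (complex.Im z)).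

(* Only meaningful for integrable f; the Berezin integrand of an L^2 function is. *)
Definition cintegral d (T : measurableType d) (mu : {measure set T -> \bar R})
    (f : T -> R[i]) : R[i] :=
  (\int[mu]_x complex.Re (f x)) +i* (\int[mu]_x complex.Im (f x)).

(* Complex-valued L^p; a class is given by any of its Borel representatives. *)
Definition cLp d (T : measurableType d) (mu : {measure set T -> \bar R})
    (p : \bar R) (f : T -> R[i]) : Prop :=
  measurable_fun setT f /\ finite_norm mu p (fun x => Normc.normc (f x)).

End complex_functions.

Section fock.
Variables (R : realType) (n : nat).
Implicit Types (z w : 'rV[R[i]]_n) (u g : 'rV[R[i]]_n -> R[i]).

(* bilinear, not sesquilinear *)
Definition bdot z w : R[i] := \sum_(k < n) z ord0 k * w ord0 k.

Definition conjv z : 'rV[R[i]]_n := map_mx (@conjc R) z.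

(* [bdot z (conjv z)] is real *)
Definition normsq z : R := complex.Re (bdot z (conjv z)).

Definition gaussian_density z : R := pi ^- n * expR (- normsq z).

Definition gaussian_measure (A : set 'rV[R[i]]_n) : \bar R :=
  (\int[lebesgue_Cn R n]_(z in A) (gaussian_density z)%:E)%E.

Lemma normsqE z :
  normsq z =
  \sum_(k < n) (complex.Re (z ord0 k) ^+ 2 + complex.Im (z ord0 k) ^+ 2).
Proof.
rewrite /normsq /bdot raddf_sum; apply: eq_bigr => k _; rewrite mxE.
by case: (z ord0 k) => a b /=; rewrite mulrN opprK -!expr2.
Qed.

Lemma measurable_normsq : measurable_fun setT normsq.
Proof.
rewrite (funext normsqE).
apply: (@measurable_sum _ _ _ _ _ _ (fun (k : 'I_n) z =>
  complex.Re (z ord0 k) ^+ 2 + complex.Im (z ord0 k) ^+ 2)) => k.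
apply: measurable_funD; apply: measurable_funX.
- exact: (measurableT_comp (@measurable_Re R) (measurable_rV_coord _)).
- exact: (measurableT_comp (@measurable_Im R) (measurable_rV_coord _)).
Qed.

Lemma measurable_gaussian_density : measurable_fun setT gaussian_density.
Proof.
apply: measurable_funM => //.
apply: (measurableT_comp (@measurable_expR R)).
exact: measurable_funN measurable_normsq.
Qed.

Lemma gaussian_density_ge0 z : 0 <= gaussian_density z.
Proof. by rewrite mulr_ge0 ?expR_ge0// invr_ge0 exprn_ge0// pi_ge0. Qed.

Let gaussian_measure0 : gaussian_measure set0 = 0%E.
Proof. by rewrite /gaussian_measure integral_set0. Qed.

Let gaussian_measure_ge0 A : (0 <= gaussian_measure A)%E.
Proof. by apply: integral_ge0 => z _; rewrite lee_fin gaussian_density_ge0. Qed.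

Let gaussian_measure_sigma_additive : semi_sigma_additive gaussian_measure.
Proof.
apply: semi_sigma_additive_nng_induced => [|z].
- by apply/measurable_EFinP; exact: measurable_gaussian_density.
- by rewrite lee_fin gaussian_density_ge0.
Qed.

HB.instance Definition _ := isMeasure.Build _ _ _ gaussian_measure
  gaussian_measure0 gaussian_measure_ge0 gaussian_measure_sigma_additive.

(* [differentiable] is Frechet differentiability over the scalar field R[i],
   so this is holomorphy on all of C^n. *)
Definition entire g : Prop := forall z, differentiable g z.

Definition Sym u : Prop :=
  measurable_fun setT u /\
  forall c : R, 0 < c ->
    cLp (lebesgue_Cn R n) +oo%E (fun z => u z * (expR (- (c * normsq z)))%:C).

Definition fock_kernel w z : R[i] := cexp (bdot w (conjv z)).

Definition normalized_kernel w z : R[i] :=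
  fock_kernel w z / sqrtc (fock_kernel z z).

Definition berezin u z : R[i] :=
  cintegral gaussian_measure (fun w => u w * `|normalized_kernel w z| ^+ 2).

End fock.

(* Main.v *)
(* The Berezin transform is convolution with the Gaussian [pi^-n e^{-|z|^2}], so
   the claim splits into two parts.

   Uniqueness: if [\int h(w) e^{2 Re(w . conj z)} dV(w) = 0] for all [z], then
   [h = 0] a.e. The functions [psi] such that every such [h] yields another one,
   [psi h], form an algebra closed under limits dominated by exponentials of
   linear forms. It contains the real linear forms [L] (differentiate in [z]),
   hence [cos L] and [sin L] (power series), hence the sign of [sin L]
   (polynomial iteration), hence the sign of [L - c] (let the frequency tend to
   0), so the sets with indicator function in it form a sigma-algebra containing
   all half-spaces: [h] integrates to 0 over every Borel set.

   Existence: completing the square and translating, the Berezin transform of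
   [e^{z.1} conj(g(z-1))] at [z] is a Gaussian mean of an entire function of
   controlled growth, conjugated. The Gaussian is invariant under
   [z |-> e^{it} z], so this mean is the value at the center, by the mean value
   property on circles. That in turn is Goursat's theorem for [phi(e^{s+it})] on
   rectangles [[s, 0] x [0, 2 pi]] with [s -> -oo]. *)

Require Import Defs.
From HB Require Import structures.
From mathcomp Require Import all_boot all_order all_algebra.
From mathcomp Require Import all_classical all_reals all_analysis.
From mathcomp Require Import measurable_realfun ess_sup_inf.
From mathcomp Require Import complex.
From mathcomp Require Import ring lra.

Set Implicit Arguments.
Unset Strict Implicit.
Unset Printing Implicit Defensive.

Import Order.TTheory GRing.Theory Num.Theory.
Import numFieldNormedType.Exports.

Local Open Scope classical_set_scope.
Local Open Scope ring_scope.
Local Open Scope complex_scope.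

(** * Goursat's theorem for closed fields on rectangles *)

(** [entire] gives differentiability at each point but no continuity of the derivative, so Green's
    theorem is out of reach and the bisection of rectangles takes its place. Uniqueness would
    classically be obtained by continuing the vanishing integral to imaginary frequencies and
    inverting a Fourier transform; the multiplier algebra reaches the trigonometric functions by
    real-variable means alone. It is closed under limits because [exp |L| <= exp L + exp (- L)]: the
    dominating functions are exponentials already known to be integrable against [h]. On the
    existence side, conjugation is removed by taking real and imaginary parts, since either part of
    [K * conjc x] is the real part of [k * x] for some constant [k]; only real parts of entire
    functions have to be averaged. [Sym] supplies an almost everywhere bound by a multiple of
    [exp (c |z|^2)], with [c] so small that the Gaussian absorbs both a translation and a linear
    exponential. *)

Lemma Rintegral_chasles (R : realType) (f : R -> R) (a m b : R) :
  continuous f -> a <= m -> m <= b ->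
  \int[lebesgue_measure]_(x in `[a, b]) f x =
  \int[lebesgue_measure]_(x in `[a, m]) f x +
  \int[lebesgue_measure]_(x in `[m, b]) f x.
Proof.
move=> cf am mb.
have fi c d : lebesgue_measure.-integrable `[c, d] (EFin \o f).
  apply: continuous_compact_integrable; first exact: segment_compact.
  exact: continuous_subspaceT.
rewrite -(@Rintegral_itv_obnd_cbnd _ m); last first.
  by apply: integrableS (fi m b) => //; apply: subset_itv_oc_cc.
rewrite -(@Rintegral_itvB _ _ (BLeft a) (BRight b) m) ?bnd_simp//.
by rewrite addrC subrK.
Qed.

Lemma Rintegral_itv_sub_bound (R : realType) (f : R -> R) (k e a b : R) :
  continuous f -> a <= b -> {in `[a, b], forall x, `|f x - k| <= e} ->
  `|\int[lebesgue_measure]_(x in `[a, b]) f x - k * (b - a)| <= e * (b - a).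
Proof.
move=> cf ab fk.
have cint (h : R -> R) : continuous h ->
    lebesgue_measure.-integrable `[a, b] (EFin \o h).
  move=> ch; apply: continuous_compact_integrable; first exact: segment_compact.
  exact: continuous_subspaceT.
have muab : fine (lebesgue_measure `[a, b]) = b - a.
  rewrite lebesgue_measure_itv /= lte_fin; case: ltgtP ab => //= -> _.
  by rewrite subrr.
have cst_int (c : R) :
    \int[lebesgue_measure]_(x in `[a, b]) c = c * (b - a).
  by rewrite Rintegral_cst// muab.
rewrite -cst_int -RintegralB//; [|exact: cint|by apply: cint => x; exact: cvg_cst].
rewrite (le_trans (le_normr_Rintegral _ _))//.
  by apply: cint => x; apply: cvgB; [exact: cf|exact: cvg_cst].
rewrite -cst_int; apply: le_Rintegral => //.
- apply: cint => x; apply: cvg_norm; apply: cvgB; [exact: cf|exact: cvg_cst].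
- by apply: cint => x; exact: cvg_cst.
Qed.

(** The counterclockwise integral of [P dx + Q dy] along the boundary of a rectangle; [X] and [Y]
    are the pairs of endpoints of its two projections. *)
Definition circulation (R : realType) (P Q : R -> R -> R)
    (X Y : R * R) : R :=
  \int[lebesgue_measure]_(x in `[X.1, X.2]) P x Y.1
  - \int[lebesgue_measure]_(x in `[X.1, X.2]) P x Y.2
  + \int[lebesgue_measure]_(y in `[Y.1, Y.2]) Q X.2 y
  - \int[lebesgue_measure]_(y in `[Y.1, Y.2]) Q X.1 y.

(* The middle coefficient [q] is shared: it is both dP/dy and dQ/dx. *)
Definition closed_at (R : realType) (P Q : R -> R -> R) (x0 y0 : R) : Prop :=
  exists p q r : R, forall e, 0 < e -> exists2 d, 0 < d &
    forall x y, `|x - x0| <= d -> `|y - y0| <= d ->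
      `|P x y - P x0 y0 - (p * (x - x0) + q * (y - y0))|
        <= e * (`|x - x0| + `|y - y0|) /\
      `|Q x y - Q x0 y0 - (q * (x - x0) + r * (y - y0))|
        <= e * (`|x - x0| + `|y - y0|).

Lemma linear_approx_continuous (R : realType) (f : R -> R) (x0 p : R) :
  (forall e, 0 < e -> exists2 d, 0 < d &
    forall x, `|x - x0| <= d -> `|f x - f x0 - p * (x - x0)| <= e * `|x - x0|) ->
  {for x0, continuous f}.
Proof.
move=> fp; have [d d0 fd] := fp 1 ltr01.
apply/cvgrPdist_lt => e e0; near=> x.
have xd : `|x - x0| <= d.
  by rewrite distrC ltW//; near: x; exact: cvgr_dist_lt.
have xe : (1 + `|p|) * `|x - x0| < e.
  rewrite -ltr_pdivlMl; last by rewrite ltr_pwDl.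
  rewrite distrC; near: x; apply: cvgr_dist_lt => //.
  by rewrite mulr_gt0// invr_gt0 ltr_pwDl.
rewrite distrC; apply: le_lt_trans xe.
have := fd x xd; rewrite mul1r => fx.
rewrite -[f x - f x0](subrK (p * (x - x0))).
by rewrite (le_trans (ler_normD _ _))// mulrDl mul1r lerD// normrM.
Unshelve. all: by end_near. Qed.

Section closed_field.
Variables (R : realType) (P Q : R -> R -> R).
Hypothesis PQ : forall x y, closed_at P Q x y.

Lemma closed_field_continuousl y : continuous (P ^~ y).
Proof.
move=> x; have [p [q [r h]]] := PQ x y.
apply: (@linear_approx_continuous _ _ _ p) => e e0.
have [d d0 hd] := h e e0; exists d => // z zd.
have [|+ _] := hd z y zd; first by rewrite subrr normr0 ltW.
by rewrite subrr normr0 !addr0 mulr0 addr0.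
Qed.

Lemma closed_field_continuousr x : continuous (Q x).
Proof.
move=> y; have [p [q [r h]]] := PQ x y.
apply: (@linear_approx_continuous _ _ _ r) => e e0.
have [d d0 hd] := h e e0; exists d => // z zd.
have [|_] := hd x z _ zd; first by rewrite subrr normr0 ltW.
by rewrite subrr normr0 add0r mulr0 add0r.
Qed.

Let mid (X : R * R) := (X.1 + X.2) / 2.
Let half (i : bool) (X : R * R) := if i then (mid X, X.2) else (X.1, mid X).

(** Each interior side is shared by two quarters, which traverse it in opposite directions. *)
Lemma circulation_quarters X Y : X.1 <= X.2 -> Y.1 <= Y.2 ->
  circulation P Q X Y =
  circulation P Q (half false X) (half false Y)
  + circulation P Q (half true X) (half false Y)
  + circulation P Q (half false X) (half true Y)
  + circulation P Q (half true X) (half true Y).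
Proof.
move=> X12 Y12; rewrite /circulation /=.
have midX : X.1 <= mid X <= X.2 by rewrite /mid; apply/andP; split; lra.
have midY : Y.1 <= mid Y <= Y.2 by rewrite /mid; apply/andP; split; lra.
move/andP: midX => [X1 X2]; move/andP: midY => [Y1 Y2].
rewrite (Rintegral_chasles (@closed_field_continuousl Y.1) X1 X2).
rewrite (Rintegral_chasles (@closed_field_continuousl Y.2) X1 X2).
rewrite (Rintegral_chasles (@closed_field_continuousr X.1) Y1 Y2).
rewrite (Rintegral_chasles (@closed_field_continuousr X.2) Y1 Y2).
by ring.
Qed.

(** Between opposite sides [P] changes by about [q * (Y.1 - Y.2)] and [Q] by about
    [q * (X.2 - X.1)]. As [q] is shared, the two main terms cancel after integration and only the
    errors remain. *)
Lemma circulation_local x0 y0 e : 0 < e -> exists2 d, 0 < d &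
  forall X Y, x0 \in `[X.1, X.2] -> y0 \in `[Y.1, Y.2] ->
    X.2 - X.1 + (Y.2 - Y.1) <= d ->
    `|circulation P Q X Y| <= e * (X.2 - X.1 + (Y.2 - Y.1)) ^+ 2.
Proof.
move=> e0; have [p [q [r h]]] := PQ x0 y0.
(* [A1] and [A2] compare values at two points each, which doubles the error. *)
have e20 : 0 < e / 2 by rewrite divr_gt0.
have [d d0 hd] := h _ e20; exists d => // -[a b] [a' b'] /=.
rewrite !in_itv/= => /andP[ax xb] /andP[ay yb].
set l := b - a + (b' - a') => ld.
have cint (u v : R) (f : R -> R) : continuous f ->
    lebesgue_measure.-integrable `[u, v] (EFin \o f).
  move=> ch; apply: continuous_compact_integrable; first exact: segment_compact.
  exact: continuous_subspaceT.
have cB (f g : R -> R) : continuous f -> continuous g ->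
    continuous (fun x => f x - g x).
  by move=> cf cg x; apply: cvgB; [exact: cf|exact: cg].
have bnd x y : a <= x <= b -> a' <= y <= b' ->
   `|P x y - P x0 y0 - (p * (x - x0) + q * (y - y0))| <= e / 2 * l /\
   `|Q x y - Q x0 y0 - (q * (x - x0) + r * (y - y0))| <= e / 2 * l.
  move=> /andP[? ?] /andP[? ?].
  have xx : `|x - x0| <= b - a by rewrite ler_norml; apply/andP; split; lra.
  have yy : `|y - y0| <= b' - a' by rewrite ler_norml; apply/andP; split; lra.
  have [||h1 h2] := hd x y.
  - by apply: le_trans ld; rewrite /l; lra.
  - by apply: le_trans ld; rewrite /l; lra.
  by split; [apply: le_trans h1 _|apply: le_trans h2 _];
     rewrite ler_pM2l// /l lerD.
have eqle (u v s t : R) : u = v -> s = t -> `|u| <= s -> `|v| <= t.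
  by move=> -> ->.
have A1 : `|\int[lebesgue_measure]_(x in `[a, b]) (P x a' - P x b')
            - q * (a' - b') * (b - a)| <= e * l * (b - a).
  apply: Rintegral_itv_sub_bound; [|lra|].
    by apply: cB; exact: closed_field_continuousl.
  move=> x; rewrite in_itv/= => xab.
  have [|h1 _] := bnd x a' xab; first by apply/andP; split; lra.
  have [|h2 _] := bnd x b' xab; first by apply/andP; split; lra.
  by apply: eqle (le_trans (ler_normB _ _) (lerD h1 h2)); [ring|field].
have A2 : `|\int[lebesgue_measure]_(y in `[a', b']) (Q b y - Q a y)
            - q * (b - a) * (b' - a')| <= e * l * (b' - a').
  apply: Rintegral_itv_sub_bound; [|lra|].
    by apply: cB; exact: closed_field_continuousr.
  move=> y; rewrite in_itv/= => yab.
  have [|_ h1] := bnd b y _ yab; first by apply/andP; split; lra.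
  have [|_ h2] := bnd a y _ yab; first by apply/andP; split; lra.
  by apply: eqle (le_trans (ler_normB _ _) (lerD h1 h2)); [ring|field].
move: A1 A2; rewrite !RintegralB//;
  try by apply: cint; (exact: closed_field_continuousl ||
                       exact: closed_field_continuousr).
move=> A1 A2; apply: eqle (le_trans (ler_normD _ _) (lerD A1 A2)).
  by rewrite /circulation/=; ring.
by rewrite /l; ring.
Qed.

(** Goursat's bisection: some quarter always keeps at least a fourth of the circulation, whereas
    near the point common to all chosen rectangles the [n]-th one has circulation at most
    [e * l ^+ 2 / 4 ^+ n], with [e] arbitrary. *)
Lemma circulation_eq0 X Y : X.1 < X.2 -> Y.1 <= Y.2 ->
  circulation P Q X Y = 0.
Proof.
move=> X12 Y12; apply/eqP; rewrite -normr_eq0 eq_le normr_ge0 andbT leNgt.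
apply/negP => E0.
(* The order hypotheses stand under the existential so that [choice] selects a quarter for every
   [Z], degenerate or not. *)
have step (Z : (R * R) * (R * R)) : exists ij : bool * bool,
    Z.1.1 <= Z.1.2 -> Z.2.1 <= Z.2.2 ->
    `|circulation P Q Z.1 Z.2| <=
    4 * `|circulation P Q (half ij.1 Z.1) (half ij.2 Z.2)|.
  apply: contrapT => /forallNP H.
  have [Z1|Z1] := leP Z.1.1 Z.1.2; last first.
    by have := H (true, true); apply => /(lt_le_trans Z1); rewrite ltxx.
  have [Z2|Z2] := leP Z.2.1 Z.2.2; last first.
    by have := H (true, true); apply => _ /(lt_le_trans Z2); rewrite ltxx.
  have {}H i j : 4 * `|circulation P Q (half i Z.1) (half j Z.2)|
      < `|circulation P Q Z.1 Z.2|.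
    rewrite ltNge; apply/negP => ij; apply: (H (i, j)) => _ _; exact: ij.
  have := H true true; have := H true false; have := H false true.
  have := H false false.
  rewrite (circulation_quarters Z1 Z2).
  set q1 := circulation _ _ (half false _) (half false _).
  set q2 := circulation _ _ (half true _) (half false _).
  set q3 := circulation _ _ (half false _) (half true _).
  set q4 := circulation _ _ (half true _) (half true _).
  have := ler_normD (q1 + q2 + q3) q4; have := ler_normD (q1 + q2) q3.
  have := ler_normD q1 q2; lra.
have [next nextP] := choice step.
pose Z := fix Z n := if n is n'.+1 then
  (half (next (Z n')).1 (Z n').1, half (next (Z n')).2 (Z n').2) else (X, Y).
have halfP i W : W.1 <= W.2 -> [/\ (half i W).1 <= (half i W).2,
    W.1 <= (half i W).1, (half i W).2 <= W.2 &
    (half i W).2 - (half i W).1 = (W.2 - W.1) / 2].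
  by move=> W12; rewrite /half /mid; case: i => /=; split; lra.
have Zle n : (Z n).1.1 <= (Z n).1.2 /\ (Z n).2.1 <= (Z n).2.2.
  elim: n => [|n [IH1 IH2]] /=; first by split => //; exact: ltW.
  have [? _ _ _] := halfP (next (Z n)).1 _ IH1.
  by have [? _ _ _] := halfP (next (Z n)).2 _ IH2.
have nested (f : (R * R) * (R * R) -> R * R) (g : bool * bool -> bool) :
    (forall n, (f (Z n)).1 <= (f (Z n)).2) ->
    (forall n, f (Z n.+1) = half (g (next (Z n))) (f (Z n))) ->
    (forall n, (f (Z n)).2 - (f (Z n)).1 = ((f (Z 0)).2 - (f (Z 0)).1) / 2 ^+ n)
    /\ exists x0, forall n, x0 \in `[(f (Z n)).1, (f (Z n)).2].
  move=> fle fS; split.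
    elim=> [|n IH]; first by rewrite expr0 divr1.
    rewrite fS; have [_ _ _ ->] := halfP (g (next (Z n))) _ (fle n).
    by rewrite IH exprS invfM; ring.
  have mono n k : (f (Z n)).1 <= (f (Z (n + k)%N)).1 /\
                  (f (Z (n + k)%N)).2 <= (f (Z n)).2.
    elim: k => [|k [IH1 IH2]]; first by rewrite addn0.
    rewrite addnS fS; have [_ h1 h2 _] := halfP (g (next (Z (n + k)%N))) _ (fle (n + k)%N).
    by split; [exact: le_trans h1|exact: le_trans IH2].
  have le12 m n : (f (Z m)).1 <= (f (Z n)).2.
    have [mn|/ltnW nm] := leqP m n.
      have [h _] := mono m (n - m)%N; rewrite subnKC// in h.
      exact: le_trans h (fle n).
    have [_ h] := mono n (m - n)%N; rewrite subnKC// in h.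
    exact: le_trans (fle m) h.
  (* The common point is the supremum of the left ends, which every right end bounds. *)
  exists (sup (range (fun n => (f (Z n)).1))) => n; rewrite in_itv/=.
  apply/andP; split.
    apply: ub_le_sup; last by exists n.
    by exists (f (Z 0)).2 => _ [m _ <-].
  apply: ge_sup; first by exists (f (Z 0)).1; exists 0%N.
  by move=> _ [m _ <-].
have [wX [x0 x0P]] := nested fst fst (fun n => (Zle n).1) (fun=> erefl).
have [wY [y0 y0P]] := nested snd snd (fun n => (Zle n).2) (fun=> erefl).
have En n : `|circulation P Q X Y| <=
    4 ^+ n * `|circulation P Q (Z n).1 (Z n).2|.
  elim: n => [|n IH]; first by rewrite expr0 mul1r.
  apply: (le_trans IH); rewrite exprSr -mulrA ler_pM2l ?exprn_gt0//.
  by have [h1 h2] := Zle n; have := nextP (Z n) h1 h2.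
set l := X.2 - X.1 + (Y.2 - Y.1).
have l0 : 0 < l by rewrite /l; lra.
set E := `|circulation P Q X Y| in E0 En.
(* With this [e] the local bound, multiplied by [4 ^+ n], is exactly [E / 2], against [En]. *)
have e0 : 0 < E / (2 * l ^+ 2) by rewrite divr_gt0// mulr_gt0// exprn_gt0.
have [d d0 hd] := circulation_local x0 y0 e0.
have ln n : (Z n).1.2 - (Z n).1.1 + ((Z n).2.2 - (Z n).2.1) = l / 2 ^+ n.
  by rewrite wX wY -mulrDl.
have [n nd] : exists n, l / 2 ^+ n <= d.
  have h := @cvg_geometric R l 2^-1.
  have : @geometric R l 2^-1 n @[n --> \oo] --> (0 : R).
    by apply: h; rewrite ger0_norm// invf_lt1// ltr1n.
  move/cvgr0_norm_le => /(_ d d0) [N _ HN]; exists N.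
  have := HN N (leqnn _); rewrite /geometric/= exprVn; apply: le_trans.
  exact: ler_norm.
have := hd _ _ (x0P n) (y0P n); rewrite ln => /(_ nd) => small.
have := En n; rewrite leNgt => /negP; apply.
rewrite (@le_lt_trans _ _ (E / 2))//; last by lra.
apply: (@le_trans _ _ (4 ^+ n * (E / (2 * l ^+ 2) * (l / 2 ^+ n) ^+ 2))).
  by rewrite ler_pM2l ?exprn_gt0.
rewrite expr_div_n -exprM (mulnC n) exprM (_ : (2 : R) ^+ 2 = 4); last by ring.
have n40 : (4 : R) ^+ n != 0 by rewrite expf_neq0// pnatr_eq0.
have l00 : l != 0 by rewrite gt_eqF.
by rewrite le_eqVlt; apply/orP; left; apply/eqP; field; rewrite n40 l00.
Qed.

End closed_field.

(** * Complex differentiability and the mean value property on circles *)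

Notation normc := Normc.normc.

Section complex_differentiability.
Variable R : realType.
Implicit Types (z h : R[i]) (F : R[i] -> R[i]).

Lemma normcEC z : `|z| = (normc z)%:C. Proof. by []. Qed.

Lemma normc_ge0 z : 0 <= normc z.
Proof. by case: z => a b; rewrite sqrtr_ge0. Qed.

Lemma normc_Re_le z : `|complex.Re z| <= normc z.
Proof. by have := normc_ge_Re z; rewrite normcEC lecR. Qed.

Lemma normc_Im_le z : `|complex.Im z| <= normc z.
Proof.
by case: z => a b /=; rewrite -sqrtr_sqr ler_wsqrtr// lerDr sqr_ge0.
Qed.

Lemma normc_le_ReIm z : normc z <= `|complex.Re z| + `|complex.Im z|.
Proof.
case: z => a b /=; rewrite -[leRHS]ger0_norm ?addr_ge0// -sqrtr_sqr ler_wsqrtr//.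
by rewrite sqrrD !real_normK ?num_real// addrAC lerDl mulrn_wge0 ?mulr_ge0.
Qed.

Lemma normc_eq0 z : (normc z == 0) = (z == 0).
Proof. by apply/eqP/eqP => [/Normc.eq0_normc//|->]; exact: Normc.normc0. Qed.

(** The order on [R[i]] is partial and its positive elements are real, so the epsilons and radii of
    limits in [R[i]] can be taken in [R]. *)
Lemma complex_gt0P (e : R[i]) : 0 < e -> exists2 r : R, 0 < r & e = r%:C.
Proof.
case: e => a b; rewrite ltcE /= => /andP[/eqP -> a0]; by exists a.
Qed.

(** Multiplying the difference quotient by [h] removes the division and lets the estimate include
    [h = 0]. *)
Lemma complex_derivableP F z : derivable F z 1 <->
  exists A, forall e : R, 0 < e -> exists2 d : R, 0 < d &
    forall h, normc h <= d -> normc (F (h + z) - F z - h * A) <= e * normc h.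
Proof.
split.
- move=> /cvg_ex[A /cvgrPdist_le FA]; exists A => e e0.
  have e0' : 0 < e%:C by rewrite ltcR.
  have [d /= /complex_gt0P[r r0 ->] Hd] := FA _ e0'.
  exists (r / 2); first by rewrite divr_gt0.
  move=> h hr; have [->|h0] := eqVneq h 0.
    by rewrite add0r subrr mul0r subr0 Normc.normc0 mulr0.
  have := Hd h; rewrite /= sub0r normrN normcEC ltcR.
  have -> : normc h < r by apply: (le_lt_trans hr); rewrite ltr_pdivrMr// ltr_pMr// ltr1n.
  move=> /(_ isT h0); rewrite normcEC lecR => hA.
  have -> : F (h + z) - F z - h * A =
      - (h * (A - h^-1 *: (F (h *: 1 + z) - F z))).
    rewrite -[h *: 1]/(h * 1) mulr1 mulrBr.
    rewrite -[h^-1 *: (F (h + z) - F z)]/(h^-1 * (F (h + z) - F z)).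
    by rewrite mulrA mulfV// mul1r; ring.
  by rewrite normcN Normc.normcM mulrC ler_wpM2r// normc_ge0.
- move=> [A FA]; apply/cvg_ex; exists A; apply/cvgrPdist_le => e.
  move=> /complex_gt0P[r r0 ->]; have [d d0 Hd] := FA r r0.
  exists d%:C => /=; first by rewrite ltcR.
  move=> h /=; rewrite sub0r normrN normcEC ltcR => hd h0.
  rewrite normcEC lecR -(ler_pM2l (_ : 0 < normc h)); last first.
    by rewrite lt_def normc_eq0 h0 normc_ge0.
  rewrite -Normc.normcM -normcN (mulrC _ r).
  have := Hd h (ltW hd).
  have -> // : F (h + z) - F z - h * A =
      - (h * (A - h^-1 *: (F (h *: 1 + z) - F z))).
  rewrite -[h *: 1]/(h * 1) mulr1 mulrBr.
  rewrite -[h^-1 *: (F (h + z) - F z)]/(h^-1 * (F (h + z) - F z)).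
  by rewrite mulrA mulfV// mul1r; ring.
Qed.

Lemma complex_differentiableP F z : differentiable F z <->
  exists A, forall e : R, 0 < e -> exists2 d : R, 0 < d &
    forall h, normc h <= d -> normc (F (h + z) - F z - h * A) <= e * normc h.
Proof. by rewrite -complex_derivableP; exact: iff_sym (derivable1_diffP F z). Qed.

Lemma cexpD z z' : cexp (z + z') = cexp z * cexp z'.
Proof.
case: z z' => [a b] [c d]; rewrite /cexp /= expRD cosD sinD.
by apply/eqP; rewrite eq_complex /=; apply/andP; split; apply/eqP; ring.
Qed.

Lemma cexp0 : cexp (0 : R[i]) = 1.
Proof. by rewrite /cexp /= expR0 cos0 sin0 mul1r. Qed.

End complex_differentiability.

Lemma is_derive_approx (R : realType) (f : R -> R) (x0 D : R) :
  is_derive x0 1 f D ->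
  forall e, 0 < e -> exists2 d, 0 < d &
    forall x, `|x| <= d -> `|f (x + x0) - f x0 - x * D| <= e * `|x|.
Proof.
move=> [df fD] e e0.
have /cvgrPdist_le/(_ _ e0)[d /= d0 Hd] :
    (fun h => h^-1 *: ((f \o shift x0) (h *: 1) - f x0)) @ 0^' --> D.
  by rewrite -fD.
exists (d / 2); first by rewrite divr_gt0.
move=> x xd; have [->|x_neq0] := eqVneq x 0.
  by rewrite add0r subrr mul0r subr0 normr0 mulr0.
have := Hd x; rewrite /= sub0r normrN.
have -> : `|x| < d by apply: (le_lt_trans xd); rewrite ltr_pdivrMr// ltr_pMr// ltr1n.
move=> /(_ isT x_neq0) hD.
have -> : f (x + x0) - f x0 - x * D =
    - (x * (D - x^-1 *: (f (x *: 1 + x0) - f x0))).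
  rewrite -[x *: 1]/(x * 1) mulr1 mulrBr.
  rewrite -[x^-1 *: (f (x + x0) - f x0)]/(x^-1 * (f (x + x0) - f x0)).
  by rewrite mulrA mulfV// mul1r; ring.
by rewrite normrN normrM mulrC ler_wpM2r.
Qed.

(** The real and imaginary parts of the error are written in terms of the first-order errors of
    [expR], [cos] and [sin] at 0. *)
Lemma cexp_approx0 (R : realType) (e : R) : 0 < e -> exists2 d, 0 < d &
  forall h : R[i], normc h <= d -> normc (cexp h - 1 - h) <= e * normc h.
Proof.
move=> e0.
wlog e1 : e e0 / e <= 1.
  move=> H; have [|//|d d0 Hd] := H (Num.min e 1).
  - by rewrite lt_min e0 ltr01.
  - by rewrite ge_min lexx orbT.
  exists d => // h hd; apply: (le_trans (Hd h hd)).
  by rewrite ler_wpM2r ?normc_ge0// ge_min lexx.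
(* The total error is at most [1 + 2 + 2 + 1] sixths of [e * n], from [F1], [F2], [F3] and [E3]. *)
have e5 : 0 < e / 6 by rewrite divr_gt0.
have [d1 d10 h1] := is_derive_approx (is_derive_expR (0 : R)) e5.
have [d2 d20 h2] := is_derive_approx (is_derive_cos (0 : R)) e5.
have [d3 d30 h3] := is_derive_approx (is_derive_sin (0 : R)) e5.
(* The radius [e / 12] serves [E4]: it brings [e / 6 * n + |a|] below [e / 6]. *)
exists (Num.min (Num.min d1 d2) (Num.min d3 (e / 12))).
  by rewrite !lt_min d10 d20 d30 divr_gt0.
move=> h; rewrite !le_min => /andP[/andP[hd1 hd2] /andP[hd3 hde]].
case: h hd1 hd2 hd3 hde => a b; set n := normc _ => hd1 hd2 hd3 hde.
have n0 : 0 <= n := normc_ge0 _.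
have an : `|a| <= n := normc_Re_le (a +i* b).
have bn : `|b| <= n := normc_Im_le (a +i* b).
have E1 : `|expR a - 1 - a| <= e / 6 * n.
  have := h1 a (le_trans an hd1); rewrite addr0 expR0 mulr1 => /le_trans; apply.
  by rewrite ler_pM2l.
have E2 : `|cos b - 1| <= e / 6 * n.
  have := h2 b (le_trans bn hd2).
  rewrite addr0 cos0 sin0 oppr0 mulr0 subr0 => /le_trans; apply.
  by rewrite ler_pM2l.
have E3 : `|sin b - b| <= e / 6 * n.
  have := h3 b (le_trans bn hd3).
  rewrite addr0 cos0 sin0 subr0 mulr1 => /le_trans; apply.
  by rewrite ler_pM2l.
have E4 : `|expR a - 1| <= e / 6.
  rewrite -[expR a - 1](subrK a) (le_trans (ler_normD _ _))//.
  have : e / 6 * n <= 1 / 6 * (e / 12) by apply: ler_pM => //; lra.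
  lra.
have cos1 : `|cos b| <= 1 by exact: cos_max.
have -> : cexp (a +i* b) - 1 - (a +i* b) =
    ((expR a - 1 - a) * cos b + (1 + a) * (cos b - 1)) +i*
    ((expR a - 1) * sin b + (sin b - b)).
  rewrite /cexp /=; apply/eqP; rewrite eq_complex /=.
  by apply/andP; split; apply/eqP; ring.
apply: (le_trans (normc_le_ReIm _)) => /=.
have F1 : `|(expR a - 1 - a) * cos b| <= e / 6 * n.
  by rewrite normrM -[leRHS]mulr1 ler_pM.
have F2 : `|(1 + a) * (cos b - 1)| <= 2 * (e / 6 * n).
  rewrite normrM ler_pM//; apply: (le_trans (ler_normD _ _)).
  by rewrite normr1; lra.
have F3 : `|(expR a - 1) * sin b| <= e / 6 * (2 * n).
  rewrite normrM ler_pM//.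
  rewrite -[sin b](subrK b) (le_trans (ler_normD _ _))//.
  have : e / 6 * n <= 1 * n by rewrite ler_wpM2r//; lra.
  lra.
have := ler_normD ((expR a - 1 - a) * cos b) ((1 + a) * (cos b - 1)).
have := ler_normD ((expR a - 1) * sin b) (sin b - b).
lra.
Qed.

Lemma differentiable_cexp (R : realType) (z : R[i]) :
  differentiable (@cexp R) z.
Proof.
apply/complex_differentiableP; exists (cexp z) => e e0.
have m0 : 0 < normc (cexp z) + 1 by rewrite ltr_wpDl ?normc_ge0.
have [|d d0 Hd] := @cexp_approx0 R (e / (normc (cexp z) + 1)).
  by rewrite divr_gt0.
exists d => // h hd.
have -> : cexp (h + z) - cexp z - h * cexp z = cexp z * (cexp h - 1 - h).
  by rewrite cexpD; ring.
rewrite Normc.normcM.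
apply: (@le_trans _ _ (normc (cexp z) * (e / (normc (cexp z) + 1) * normc h))).
  by rewrite ler_wpM2l ?normc_ge0// Hd.
rewrite mulrA ler_wpM2r ?normc_ge0// mulrCA ler_piMr ?ltW//.
by rewrite ltr_pdivrMr// mul1r ltrDl.
Qed.

(** [Im F dx + Re F dy] is the imaginary part of [F dz]. For a derivative [a + i b], the
    Cauchy-Riemann equations give the coefficients [b], [a], [- b], with [a] the shared one. *)
Lemma closed_at_holomorphic (R : realType) (F : R[i] -> R[i]) :
  (forall z, differentiable F z) -> forall x y : R,
  closed_at (fun x y => complex.Im (F (x +i* y)))
            (fun x y => complex.Re (F (x +i* y))) x y.
Proof.
move=> dF x0 y0; have /complex_differentiableP[[a b] HA] := dF (x0 +i* y0).
exists b, a, (- b) => e e0; have [d d0 Hd] := HA e e0.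
exists (d / 2); first by rewrite divr_gt0.
move=> x y xd yd.
pose h : R[i] := (x - x0) +i* (y - y0).
have hle : normc h <= `|x - x0| + `|y - y0| by exact: (normc_le_ReIm h).
have hz : h + (x0 +i* y0) = x +i* y.
  by apply/eqP; rewrite eq_complex /= !subrK !eqxx.
have hd : normc h <= d by apply: (le_trans hle); lra.
have := Hd h hd; rewrite hz => H.
have {H} H := le_trans H (ler_wpM2l (ltW e0) hle).
move: H; rewrite /h; case: (F (x +i* y)) => u v; case: (F (x0 +i* y0)) => u0 v0.
move=> H.
split.
- apply: le_trans (le_trans (normc_Im_le _) H).
  by rewrite /= le_eqVlt; apply/orP; left; apply/eqP; congr `|_|; ring.
- apply: le_trans (le_trans (normc_Re_le _) H).
  by rewrite /= le_eqVlt; apply/orP; left; apply/eqP; congr `|_|; ring.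
Qed.

(* With [F s t = phi (exp (s + i t))], Goursat's theorem on the rectangle
   [[s, 0] x [0, 2 pi]] and the periodicity of [F] in [t] show that the mean of
   [phi] over the circle of radius [exp s] does not depend on [s]. *)
Lemma circle_mean_value (R : realType) (phi : R[i] -> R[i]) :
  (forall z, differentiable phi z) ->
  \int[lebesgue_measure]_(t in `[0, pi *+ 2]) complex.Re (phi (cexp (0 +i* t)))
  = complex.Re (phi 0) * (pi *+ 2) :> R.
Proof.
move=> dphi.
have pi0 : 0 < (pi *+ 2 : R) by rewrite mulrn_wgt0// pi_gt0.
set A := LHS; set B := RHS.
pose F z := phi (cexp z).
have dF z : differentiable F z.
  by apply: differentiable_comp; [exact: differentiable_cexp|exact: dphi].
have PQ := closed_at_holomorphic dF.
apply/eqP; rewrite -subr_eq0 -normr_eq0 eq_le normr_ge0 andbT leNgt.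
apply/negP => AB.
(* Over an interval of length [2 pi], an error [e] amounts to half the supposed gap. *)
set e := `|A - B| / (2 * (pi *+ 2)).
have e0 : 0 < e by rewrite divr_gt0// mulr_gt0.
have : {for 0, continuous phi} by exact: differentiable_continuous.
move=> /cvgrPdist_lt/(_ e%:C); rewrite ltcR => /(_ e0)[d' /= /complex_gt0P[d d0 ->] Hd].
(* The bound [-1] keeps the rectangle nondegenerate; the other one puts the circle of radius [exp s]
   where [phi] is within [e] of [phi 0]. *)
pose s : R := Num.min (-1) (ln (d / 2)).
have s0 : s < 0 by rewrite gt_min ltrN10.
have sd : expR s < d.
  have : expR s <= d / 2.
    rewrite -[leRHS]lnK ?posrE ?divr_gt0// ler_expR.
    by rewrite ge_min lexx orbT.
  by move/le_lt_trans; apply; lra.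
have E : \int[lebesgue_measure]_(t in `[0, pi *+ 2]) complex.Re (F (s +i* t)) = A.
  have := circulation_eq0 PQ (X := (s, 0)) (Y := (0, pi *+ 2)) s0 (ltW pi0).
  rewrite /circulation /=.
  have -> : \int[lebesgue_measure]_(x in `[s, 0])
        complex.Im (F (x +i* 0)) =
      \int[lebesgue_measure]_(x in `[s, 0]) complex.Im (F (x +i* (pi *+ 2))).
    apply: eq_Rintegral => x _; congr (complex.Im (phi _)).
    by rewrite /cexp /= cos0 sin0 cos2pi sin2pi.
  by rewrite subrr add0r => /eqP; rewrite subr_eq0 => /eqP /esym.
have := @Rintegral_itv_sub_bound R (fun t => complex.Re (F (s +i* t)))
  (complex.Re (phi 0)) e 0 (pi *+ 2).
rewrite E subr0 -/B => H.
have : `|A - B| <= e * (pi *+ 2).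
  apply: H.
  - exact: (closed_field_continuousr PQ).
  - exact: ltW.
  - move=> t _; have := Hd (cexp (s +i* t)); rewrite /= sub0r normrN.
    rewrite normcEC ltcR /cexp /= mul0r mul0r subr0 addr0 !exprMn -mulrDr.
    rewrite cos2Dsin2 mulr1 sqrtr_sqr ger0_norm ?expR_ge0// => /(_ sd).
    rewrite normcEC ltcR -/(cexp (s +i* t)) => h.
    rewrite distrC; apply: le_trans (ltW h); apply: le_trans (normc_Re_le _).
    by rewrite /F raddfB.
rewrite /e invfM mulrA -mulrA mulVf ?gt_eqF// mulr1.
by move: AB; lra.
Qed.

(** * Functions annihilated by the exponentials of linear forms *)

Lemma expR_sub1_le (R : realType) (y : R) : `|expR y - 1| <= `|y| * expR `|y|.
Proof.
have [y0|y0] := leP 0 y.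
  have ey : 1 <= expR y by rewrite -expR0 ler_expR.
  rewrite !ger0_norm ?subr_ge0//.
  have e0 := expR_gt0 y; have := expR_ge1Dx (- y).
  rewrite -(ler_pM2l e0) mulrDr mulrN -expRD subrr expR0 mulr1; lra.
rewrite distrC ger0_norm ?subr_ge0; last by rewrite expR_le1 ltW.
rewrite ltr0_norm//; have := expR_ge1Dx y => h1.
have h2 : 1 <= expR (- y) by rewrite -expR0 ler_expR oppr_ge0 ltW.
have : - y * 1 <= - y * expR (- y) by rewrite ler_wpM2l// oppr_ge0 ltW.
lra.
Qed.

Lemma series_exp_coeff_le (R : realType) (x : R) n : 0 <= x ->
  series (exp_coeff x) n <= expR x.
Proof.
move=> x0; rewrite /expR; apply: nondecreasing_cvgn_le.
  by apply: nondecreasing_series => i _ _; rewrite exp_coeff_ge0.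
exact: is_cvg_series_exp_coeff.
Qed.

(* A polynomial whose iterates converge to the sign function on [[-1, 1]]. *)
Definition sgr_step (R : realType) (s : R) : R := (3 * s - s ^+ 3) / 2.

Lemma sgr_stepN (R : realType) n (s : R) :
  iter n (@sgr_step R) (- s) = - iter n (@sgr_step R) s.
Proof. by elim: n => //= n ->; rewrite /sgr_step; ring. Qed.

(** A step from [u] multiplies the distance to 1 by [1 - u / 2 - u ^+ 2 / 2], and the iterates never
    drop below [s]. *)
Lemma iter_sgr_step_itv (R : realType) n (s : R) : 0 <= s <= 1 ->
  s <= iter n (@sgr_step R) s <= 1 /\
  1 - iter n (@sgr_step R) s <= (1 - s / 2) ^+ n.
Proof.
move=> /andP[s0 s1]; elim: n => [|n [/andP[IH1 IH2] IH3]] /=.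
  by rewrite lexx s1 expr0; split => //; lra.
move: IH1 IH2 IH3; set u := iter _ _ _ => IH1 IH2 IH3.
have E : 1 - sgr_step u = (1 - u) * ((1 - u) * (2 + u) / 2).
  by rewrite /sgr_step; field.
have E' : sgr_step u - u = u * (1 - u) * (1 + u) / 2 by rewrite /sgr_step; field.
have D1 : 0 <= 1 - sgr_step u.
  by rewrite E !mulr_ge0// ?invr_ge0//; lra.
have D2 : 0 <= sgr_step u - u by rewrite E' !mulr_ge0// ?invr_ge0//; lra.
split; first by apply/andP; split; lra.
rewrite E exprSr; apply: ler_pM => //; first by lra.
  by rewrite !mulr_ge0// ?invr_ge0//; lra.
have : 0 <= u * u by rewrite mulr_ge0//; lra.
have -> : (1 - u) * (2 + u) / 2 = 1 - u / 2 - u * u / 2 by field.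
lra.
Qed.

Lemma iter_sgr_step_le1 (R : realType) n (s : R) : `|s| <= 1 ->
  `|iter n (@sgr_step R) s| <= 1.
Proof.
wlog s0 : s / 0 <= s => [H|].
  have [/H//|s0] := leP 0 s; rewrite -normrN => s1.
  by rewrite -normrN -sgr_stepN H// oppr_ge0 ltW.
rewrite ger0_norm// => s1.
have [|/andP[h1 h2] _] := @iter_sgr_step_itv R n s; first by rewrite s0.
by rewrite ger0_norm// (le_trans s0).
Qed.

Lemma cvg_iter_sgr_step (R : realType) (s : R) : `|s| <= 1 ->
  iter n (@sgr_step R) s @[n --> \oo] --> Num.sg s.
Proof.
wlog s0 : s / 0 <= s => [H|].
  have [/H//|s0] := leP 0 s; rewrite -normrN => s1.
  rewrite -[s]opprK sgrN; under eq_fun do rewrite sgr_stepN.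
  by apply: cvgN; apply: H => //; rewrite oppr_ge0 ltW.
rewrite ger0_norm// => s1.
move: s0; rewrite le_eqVlt => /predU1P[<-|s0].
  rewrite sgr0 (_ : (fun _ => _) = cst 0); first exact: cvg_cst.
  apply/funext; elim => //= n ->; rewrite /sgr_step; by ring.
rewrite gtr0_sg//.
have : 1 - (1 - s / 2) ^+ n @[n --> \oo] --> 1 - (0 : R).
  apply: cvgB; first exact: cvg_cst.
  by apply: cvg_expr; rewrite ger0_norm; lra.
rewrite subr0 => h.
apply: (@squeeze_cvgr _ _ _ _ _ (fun=> 1) _ _ _ h); last exact: cvg_cst.
apply: nearW => n.
have [|/andP[h1 h2] h3] := @iter_sgr_step_itv R n s; first by rewrite ltW.
by rewrite h2 andbT; lra.
Qed.

(** * The algebra of multipliers *)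

Section exponential_annihilator.
Context d (T : measurableType d) (R : realType).
Variables (mu : {measure set T -> \bar R}) (Lin : set (T -> R)).
Hypothesis Lin_measurable : forall L, Lin L -> measurable_fun setT L.
Hypothesis LinD : forall L L', Lin L -> Lin L' -> Lin (L \+ L').
Hypothesis LinZ : forall a L, Lin L -> Lin (fun x => a * L x).

(** Integrability against every exponential is part of the notion: it provides the dominating
    functions in passages to the limit. *)
Definition exp_annihilated (h : T -> R) : Prop :=
  measurable_fun setT h /\ forall L, Lin L ->
  mu.-integrable setT (fun x => (h x * expR (L x))%:E) /\
  (\int[mu]_x (h x * expR (L x))%:E = 0)%E.

(** Quantifying over all annihilated [h] makes stability under products a mere composition. *)
Definition exp_multiplier (psi : T -> R) : Prop :=
  forall h, exp_annihilated h -> exp_annihilated (fun x => psi x * h x).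

Lemma exp_multiplierM psi psi' : exp_multiplier psi -> exp_multiplier psi' ->
  exp_multiplier (fun x => psi x * psi' x).
Proof.
move=> m m' h /m' /m; congr exp_annihilated.
by apply/funext => x; rewrite mulrA.
Qed.

Lemma exp_multiplier_lin a b psi psi' : exp_multiplier psi ->
  exp_multiplier psi' -> exp_multiplier (fun x => a * psi x + b * psi' x).
Proof.
move=> m m' h hh; have [mh1 h1] := m _ hh; have [mh2 h2] := m' _ hh.
have E L x : (a * psi x + b * psi' x) * h x * expR (L x) =
    a * (psi x * h x * expR (L x)) + b * (psi' x * h x * expR (L x)).
  by ring.
split.
  have := measurable_funD (measurable_funM (measurable_cst a) mh1)
    (measurable_funM (measurable_cst b) mh2).
  by congr measurable_fun; apply/funext => x /=; ring.
move=> L LL; have [i1 e1] := h1 _ LL; have [i2 e2] := h2 _ LL.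
under eq_fun do rewrite E EFinD !EFinM.
split.
  by apply: integrableD => //; exact: integrableZl.
rewrite integralD//; [|exact: integrableZl..].
by rewrite !integralZl// e1 e2 !mule0 adde0.
Qed.

Lemma exp_multiplier_cst a : exp_multiplier (cst a).
Proof.
move=> h hh; have := @exp_multiplier_lin a 0 (cst 1) (cst 1) _ _ h hh.
rewrite /cst /= => H.
have {}H : exp_annihilated (fun x => (a * 1 + 0 * 1) * h x).
  by apply: H => g; congr exp_annihilated; apply/funext => x; rewrite mul1r.
move: H; congr exp_annihilated; apply/funext => x; by rewrite mulr1 mul0r addr0.
Qed.

Lemma exp_multiplier_sum n (c : nat -> R) (psi : nat -> T -> R) :
  (forall k, exp_multiplier (psi k)) ->
  exp_multiplier (fun x => \sum_(0 <= k < n) c k * psi k x).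
Proof.
move=> m; elim: n => [|n IH].
  have := @exp_multiplier_cst 0; congr exp_multiplier.
  by apply/funext => x; rewrite big_geq.
have := exp_multiplier_lin 1 (c n) IH (m n); congr exp_multiplier.
by apply/funext => x; rewrite big_nat_recr//= mul1r.
Qed.

Lemma exp_multiplierX psi k : exp_multiplier psi ->
  exp_multiplier (fun x => psi x ^+ k).
Proof.
move=> m; elim: k => [|k IH]; first exact: (@exp_multiplier_cst 1).
have := exp_multiplierM m IH; congr exp_multiplier.
by apply/funext => x; rewrite exprS.
Qed.

Lemma exp_multiplier_exp L : Lin L -> exp_multiplier (expR \o L).
Proof.
move=> LL h [mh hh]; split.
  apply: measurable_funM => //; apply: measurableT_comp => //.
  exact: Lin_measurable.
move=> L' LL'; have := hh _ (LinD LL LL').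
have E x : h x * expR (L x + L' x) = expR (L x) * h x * expR (L' x).
  by rewrite expRD; ring.
by under eq_fun do rewrite E.
Qed.

(** Dominated convergence: [expR |L0|] is at most [expR L0 + expR (- L0)], and both [L + L0] and
    [L - L0] are again forms in [Lin], so the dominating function [g] is integrable. *)
Lemma exp_multiplier_cvg (psi : nat -> T -> R) (phi L0 : T -> R) : Lin L0 ->
  (forall n, exp_multiplier (psi n)) ->
  (forall n x, `|psi n x| <= expR `|L0 x|) ->
  (forall x, psi n x @[n --> \oo] --> phi x) ->
  exp_multiplier phi.
Proof.
move=> LL0 m psib psil h hh; have [mh hhL] := hh.
have cvgL L x : psi n x * h x * expR (L x) @[n --> \oo] --> phi x * h x * expR (L x).
  by apply: cvgMl; apply: cvgMl; exact: psil.
have mphi : measurable_fun setT (fun x => phi x * h x).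
  apply: (@measurable_fun_cvg _ _ _ _ (fun n x => psi n x * h x)).
    by move=> n; have [] := m n _ hh.
  by move=> x _; apply: cvgMl; exact: psil.
split=> // L LL.
have mexp : measurable_fun setT (fun x => expR (L x)).
  by apply: measurableT_comp => //; exact: Lin_measurable.
have LLN : Lin (fun x => L x + (-1) * L0 x) by apply: LinD => //; exact: LinZ.
have [ip _] := hhL _ (LinD LL LL0).
have [im _] := hhL _ LLN.
pose g x := (`|(h x * expR (L x + L0 x))|%:E + `|(h x * expR (L x + -1 * L0 x))|%:E)%E.
have ig : mu.-integrable setT g.
  apply: integrableD => //.
    exact: (integrable_abse ip).
  exact: (integrable_abse im).
have [|||||i1 _ c1] := @dominated_convergence _ _ _ mu setT measurableT
  (fun n x => (psi n x * h x * expR (L x))%:E)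
  (fun x => (phi x * h x * expR (L x))%:E) g.
- move=> n; apply/measurable_EFinP; apply: measurable_funM => //.
  by have [] := m n _ hh.
- by apply/measurable_EFinP; apply: measurable_funM.
- apply: aeW => x _; apply: cvg_EFin; last exact: cvgL.
  exact: nearW.
- exact: ig.
- apply: aeW => x n _; rewrite /g -EFinD lee_fin !normrM.
  rewrite !(ger0_norm (expR_ge0 _)) -mulrDr -mulrA mulrCA ler_wpM2l//.
  apply: (@le_trans _ _ (expR `|L0 x| * expR (L x))).
    by rewrite ler_wpM2r ?expR_ge0.
  rewrite mulN1r !expRD mulrC -mulrDr ler_wpM2l ?expR_ge0//.
  have [?|?] := leP 0 (L0 x).
    by rewrite ger0_norm// lerDl expR_ge0.
  by rewrite ltr0_norm// lerDr expR_ge0.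
split=> //.
have : (\int[mu]_x (psi n x * h x * expR (L x))%:E)%E @[n --> \oo] --> 0%E.
  rewrite (_ : (fun _ => _) = cst 0%E); first exact: cvg_cst.
  by apply/funext => n; have [_ /(_ _ LL)[]] := m n _ hh.
by move/(cvg_unique _ c1); exact.
Qed.

(** [L] is the derivative of [expR (t * L)] at [t = 0], hence the limit of difference quotients with
    step [1 / (n + 1)]. *)
Lemma exp_multiplier_id L : Lin L -> exp_multiplier L.
Proof.
(* The quotients are bounded by [|L| * expR |L|], which is at most [expR |2 * L|]. *)
move=> LL; have LL2 : Lin (fun x => 2 * L x) by exact: LinZ.
apply: (@exp_multiplier_cvg
  (fun n x => n.+1%:R * expR (n.+1%:R^-1 * L x) + (- n.+1%:R) * 1) _ _ LL2).
- move=> n; apply: exp_multiplier_lin; last exact: (exp_multiplier_cst 1).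
  by apply: (@exp_multiplier_exp (fun x => _ * L x)); exact: LinZ.
- move=> n x; rewrite mulNr -mulrBr normrM ger0_norm//.
  apply: (@le_trans _ _ (`|L x| * expR `|L x|)).
    rewrite (le_trans (ler_wpM2l _ (expR_sub1_le _)))// mulrA normrM ger0_norm//.
    rewrite mulVKf ?pnatr_eq0// ler_wpM2l// ler_expR ler_piMl//.
    by rewrite invf_le1// ler1n.
  rewrite normrM ger0_norm// mulr_natl mulr2n expRD ler_wpM2r ?expR_ge0//.
  by rewrite (le_trans _ (expR_ge1Dx _))// lerDr.
- move=> x.
  have [y0|y0] := eqVneq (L x) 0.
    rewrite y0; under eq_fun do rewrite mulr0 expR0 mulNr subrr.
    exact: cvg_cst.
  have h : (fun n : nat => n.+1%:R^-1 * L x) @ \oo --> (0 * L x).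
    apply: cvgMl; exact: cvg_harmonic.
  rewrite mul0r in h.
  apply/cvgrPdist_le => e e0.
  have e1 : 0 < e / `|L x| by rewrite divr_gt0// normr_gt0.
  have [dl dl0 Hd] := is_derive_approx (is_derive_expR (0 : R)) e1.
  move/cvgr0_norm_le : h => /(_ dl dl0); apply: filterS => n /Hd.
  rewrite addr0 expR0 mulr1 normrM (ger0_norm (x := _^-1))// => H.
  rewrite distrC.
  have -> : n.+1%:R * expR (n.+1%:R^-1 * L x) + - n.+1%:R * 1 - L x =
     n.+1%:R * (expR (n.+1%:R^-1 * L x) - 1 - n.+1%:R^-1 * L x).
    by rewrite !mulrBr mulVKf ?pnatr_eq0//; ring.
  rewrite normrM ger0_norm//.
  apply: (le_trans (ler_wpM2l _ H)) => //.
  rewrite mulrCA mulVKf ?pnatr_eq0// divfK// normr_eq0//.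
Qed.

(** The bound on the coefficients makes [expR |L|] dominate all partial sums. *)
Lemma exp_multiplier_series L (c : nat -> R) (phi : T -> R) : Lin L ->
  (forall k, `|c k| <= (k`!%:R)^-1) ->
  (forall x, \sum_(0 <= k < n) c k * L x ^+ k @[n --> \oo] --> phi x) ->
  exp_multiplier phi.
Proof.
move=> LL ck; apply: (exp_multiplier_cvg LL).
- move=> n; apply: exp_multiplier_sum => k.
  by apply: exp_multiplierX; apply: exp_multiplier_id; exact: LL.
- move=> n x; apply: le_trans (series_exp_coeff_le n (normr_ge0 (L x))).
  rewrite (le_trans (ler_norm_sum _ _ _))// ler_sum// => k _.
  by rewrite normrM normrX /exp_coeff /= mulrC ler_wpM2l// exprn_ge0.
Qed.

Lemma exp_multiplier_cos L : Lin L -> exp_multiplier (cos \o L).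
Proof.
move=> LL; apply: (@exp_multiplier_series _
  (fun k => (~~ odd k)%:R * (-1) ^+ k./2 * (k`!%:R)^-1) _ LL).
  move=> k; rewrite !normrM normrX normrN1 expr1n mulr1.
  by rewrite (ger0_norm (x := _^-1))// ler_piMl// normr_nat lern1; case: (odd k).
move=> x.
rewrite (_ : (fun _ => _) = series (cos_coeff (L x))).
  rewrite /= cos.unlock; exact: is_cvg_series_cos_coeff.
by apply/funext => n; apply: eq_bigr => k _; rewrite /cos_coeff /= mulrAC.
Qed.

Lemma exp_multiplier_sin L : Lin L -> exp_multiplier (sin \o L).
Proof.
move=> LL; apply: (@exp_multiplier_series _
  (fun k => (odd k)%:R * (-1) ^+ k.-1./2 * (k`!%:R)^-1) _ LL).
  move=> k; rewrite !normrM normrX normrN1 expr1n mulr1.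
  by rewrite (ger0_norm (x := _^-1))// ler_piMl// normr_nat lern1; case: (odd k).
move=> x.
rewrite (_ : (fun _ => _) = series (sin_coeff (L x))).
  rewrite /= sin.unlock; exact: is_cvg_series_sin_coeff.
by apply/funext => n; apply: eq_bigr => k _; rewrite /sin_coeff /= mulrAC.
Qed.

(** Two nested limits: the polynomial iteration gives the sign of [sin (a * (L - c))], a multiplier
    by the subtraction formula; as [a] tends to 0 this sign becomes that of [L - c] at each
    point. *)
Lemma exp_multiplier_sgr_sub L (c : R) : Lin L ->
  exp_multiplier (fun x => Num.sg (L x - c)).
Proof.
(* The zero form turns the exponential domination into the bound 1. *)
move=> LL; have L0 : Lin (fun x => 0 * L x) by exact: LinZ.
have bound1 (y : R) x : `|y| <= 1 -> `|y| <= expR `|0 * L x|.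
  by rewrite mul0r normr0 expR0.
apply: (@exp_multiplier_cvg
  (fun n x => Num.sg (sin (n.+1%:R^-1 * (L x - c)))) _ _ L0).
- move=> n; set a := n.+1%:R^-1.
  have ms : exp_multiplier (fun x => sin (a * (L x - c))).
    have aL : Lin (fun x => a * L x) by exact: LinZ.
    have := exp_multiplier_lin (cos (a * c)) (- sin (a * c))
      (exp_multiplier_sin aL) (exp_multiplier_cos aL).
    congr exp_multiplier; apply/funext => x /=.
    by rewrite mulrBr sinB; ring.
  apply: (@exp_multiplier_cvg
    (fun m x => iter m (@sgr_step R) (sin (a * (L x - c)))) _ _ L0).
  + elim=> [//|m IH] /=.
    have := exp_multiplier_lin (3 / 2) (- 2^-1) IH (exp_multiplierX 3 IH).
    by congr exp_multiplier; apply/funext => x; rewrite /sgr_step; field.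
  + by move=> m x; apply: bound1; apply: iter_sgr_step_le1; exact: sin_max.
  + by move=> x; apply: cvg_iter_sgr_step; exact: sin_max.
- by move=> n x; apply: bound1; rewrite normr_sg; case: eqP.
- move=> x; set y := L x - c.
  apply: cvg_near_cst.
  have h : (fun n : nat => n.+1%:R^-1 * y) @ \oo --> (0 * y).
    apply: cvgMl; exact: cvg_harmonic.
  rewrite mul0r in h.
  (* On []- pi, pi[] the sine has the sign of its argument. *)
  move/cvgr0_norm_lt : h => /(_ pi (pi_gt0 R)); apply: filterS => n.
  have n0 : 0 < n.+1%:R^-1 :> R by rewrite invr_gt0.
  case: (ltgtP y 0) => [y0|y0|->] ny.
  + rewrite (ltr0_sg y0) ltr0_sg// -oppr_gt0 -sinN sin_gt0_pi//.
    rewrite -mulrN mulr_gt0 ?oppr_gt0//=.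
    by apply: le_lt_trans ny; rewrite mulrN -normrN ler_norm.
  + rewrite (gtr0_sg y0) gtr0_sg// sin_gt0_pi// mulr_gt0//=.
    by apply: le_lt_trans ny; rewrite ler_norm.
  + by rewrite mulr0 sin0.
Qed.

Definition exp_multiplier_sets : set (set T) :=
  [set A | exp_multiplier (fun x => \1_A x)].

(** The indicator of a complement is [1 - \1_A], that of a union comes from the product over the
    complements, and countable unions are limits bounded by 1. *)
Lemma exp_multiplier_sets_sigma_algebra :
  Lin !=set0 -> sigma_algebra setT exp_multiplier_sets.
Proof.
move=> [L LL].
have L0 : Lin (fun x => 0 * L x) by exact: LinZ.
have mC A : exp_multiplier_sets A -> exp_multiplier_sets (~` A).
  move=> mA; have := exp_multiplier_lin 1 (-1) (exp_multiplier_cst 1) mA.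
  congr exp_multiplier; apply/funext => x.
  by rewrite /cst !indicE in_setC; case: (x \in A) => /=; ring.
have mU A B : exp_multiplier_sets A -> exp_multiplier_sets B ->
    exp_multiplier_sets (A `|` B).
  move=> mA mB; have := exp_multiplierM (mC _ mA) (mC _ mB) => mAB.
  have := exp_multiplier_lin 1 (-1) (exp_multiplier_cst 1) mAB.
  congr exp_multiplier; apply/funext => x.
  rewrite /cst !indicE !in_setC in_setU.
  by case: (x \in A); case: (x \in B) => /=; ring.
have m0 : exp_multiplier_sets set0.
  have := @exp_multiplier_cst 0; congr exp_multiplier.
  by apply/funext => x; rewrite indic0.
split=> //.
- by move=> A /mC; rewrite setTD.
- move=> A mA.
  apply: (@exp_multiplier_cvg (fun n x => \1_(\bigcup_(k < n) A k) x) _ _ L0).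
  + elim=> [|n IH]; first by rewrite bigcup_mkord big_ord0.
    by rewrite bigcup_mkord big_ord_recr -bigcup_mkord; exact: mU.
  + by move=> n x; rewrite mul0r normr0 expR0 ger0_norm indicE; case: (_ \in _).
  + move=> x; apply: cvg_near_cst.
    have [[k _ Akx]|nA] := pselect ((\bigcup_k A k) x).
      exists k.+1 => // n /= kn; rewrite !indicE !mem_set//.
        by exists k.
      by exists k.
    apply: nearW => n; rewrite !indicE !memNset// => -[k _ Akx].
    by apply: nA; exists k.
Qed.

Lemma exp_annihilated_ae0 (h : T -> R) : Lin !=set0 ->
  measurable `<=` <<s [set A | exists L c, Lin L /\ A = [set x | c < L x]] >> ->
  exp_annihilated h -> ae_eq mu setT (EFin \o h) (cst 0%E).
Proof.
move=> Lin0 gen hh.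
have ms A : measurable A -> exp_multiplier_sets A.
  move=> /gen; apply: smallest_sub; first exact: exp_multiplier_sets_sigma_algebra.
  move=> _ [L [c [LL ->]]].
  have m := exp_multiplier_sgr_sub c LL.
  (* For a sign [s], [(s + s ^+ 2) / 2] is 1 at [s = 1] and 0 at [s = 0] and [s = -1]: the indicator
     of the open half-space. *)
  have := exp_multiplier_lin 2^-1 2^-1 m (exp_multiplierX 2 m).
  congr exp_multiplier; apply/funext => x; rewrite indicE.
  case: (ltgtP c (L x)) => cL.
  - by rewrite mem_set//= gtr0_sg ?subr_gt0//=; field.
  - rewrite memNset/=; last by apply/negP; rewrite -leNgt ltW.
    by rewrite ltr0_sg ?subr_lt0//=; field.
  - by rewrite memNset/= ?cL ?ltxx// subrr sgr0; field.
have [L LL] := Lin0; have L0 : Lin (fun x => 0 * L x) by exact: LinZ.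
have E g : (fun x => (g x * expR (0 * L x))%:E) = EFin \o g.
  by apply/funext => x; rewrite mul0r expR0 mulr1.
apply: integral_ae_eq => //.
  by have [_ /(_ _ L0)[]] := hh; rewrite E.
move=> A _ mA; rewrite integral0.
have [_ /(_ _ L0)[_]] := ms A mA _ hh; rewrite E => <-.
rewrite integral_mkcond; apply: eq_integral => x _.
by rewrite patchE /= indicE; case: (x \in A); rewrite ?mul1r ?mul0r.
Qed.

End exponential_annihilator.

(** * Integration against a density *)

Section density.
Context d (T : measurableType d) (R : realType).
Variables (mu nu : {measure set T -> \bar R}) (w : T -> R).
Hypothesis mw : measurable_fun setT w.
Hypothesis w0 : forall x, 0 <= w x.
Hypothesis nuE : forall A, measurable A -> nu A = (\int[mu]_(x in A) (w x)%:E)%E.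
Local Open Scope ereal_scope.
Import HBNNSimple.

(** [nuE] speaks of sets; simple functions and monotone convergence carry it over to integrals. *)
Lemma ge0_integral_density (f : T -> \bar R) : measurable_fun setT f ->
  (forall x, 0 <= f x) -> \int[nu]_x f x = \int[mu]_x (f x * (w x)%:E).
Proof.
move=> mf f0; pose f_ := nnsfun_approx measurableT mf.
have f_cvg x : EFin \o f_ ^~ x @ \oo --> f x by exact: cvg_nnsfun_approx.
transitivity (limn (fun n => \int[nu]_x (f_ n x)%:E)).
  rewrite -monotone_convergence//.
  - by apply: eq_integral => x _; apply/esym/cvg_lim => //; exact: f_cvg.
  - by move=> n; exact/measurable_EFinP/measurable_funP.
  - by move=> n x _; rewrite lee_fin.
  - by move=> x _ m n mn; rewrite lee_fin; exact/lefP/nd_nnsfun_approx.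
transitivity (limn (fun n => \int[mu]_x ((f_ n x)%:E * (w x)%:E))); last first.
  rewrite -monotone_convergence//.
  - apply: eq_integral => x _; apply/cvg_lim => //.
    by apply: cvgeMr => //; exact: f_cvg.
  - move=> n; apply: emeasurable_funM; last exact/measurable_EFinP.
    exact/measurable_EFinP/measurable_funP.
  - by move=> n x _; rewrite mule_ge0// lee_fin.
  - move=> x _ m n mn; rewrite lee_wpmul2r ?lee_fin//.
    exact/lefP/nd_nnsfun_approx.
congr (limn _); apply/funext => n.
rewrite integralT_nnsfun sintegralE.
transitivity (\int[mu]_x (\sum_(k \in range (f_ n))
    (k * \1_(f_ n @^-1` [set k]) x * w x)%:E)).
  rewrite ge0_integral_fsum//; last 2 first.
  - move=> k; apply/measurable_EFinP; apply: measurable_funM => //.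
    exact: measurable_funM.
  - move=> k x _; rewrite lee_fin mulr_ge0//.
    by rewrite -lee_fin nnfun_muleindic_ge0.
  apply: eq_fsbigr => k _.
  have [k0|k0] := leP 0%R k; last first.
    rewrite preimage_nnfun0// measure0 mule0 integral0_eq// => x _.
    by rewrite indic0 mulr0 mul0r.
  rewrite nuE; last exact: measurable_sfunP.
  rewrite -ge0_integralZl//; last first.
  - by move=> x _; rewrite lee_fin.
  - exact/measurable_EFinP/measurable_funTS.
  rewrite integral_mkcond; apply: eq_integral => x _.
  rewrite patchE indicE; case: (_ \in _); first by rewrite mulr1 EFinM.
  by rewrite mulr0 mul0r.
apply: eq_integral => x _; rewrite fimfunE -fsumEFin//.
rewrite ge0_mule_fsuml//; last by move=> k; exact: nnfun_muleindic_ge0.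
Qed.

Lemma integrable_density (f : T -> R) : measurable_fun setT f ->
  mu.-integrable setT (fun x => (f x * w x)%:E) <->
  nu.-integrable setT (EFin \o f).
Proof.
move=> mf.
have mfw : measurable_fun setT (fun x => (f x * w x)%:E).
  by apply/measurable_EFinP; exact: measurable_funM.
have E : \int[nu]_x `|(EFin \o f) x| = \int[mu]_x `|(f x * w x)%:E|.
  rewrite ge0_integral_density//.
    by apply: eq_integral => x _; rewrite /= -EFinM normrM (ger0_norm (w0 x)).
  by apply: measurableT_comp => //; exact/measurable_EFinP.
split=> /integrableP[m fi]; apply/integrableP; split => //.
- exact/measurable_EFinP.
- by rewrite E.
- by rewrite -E.
Qed.

Lemma integral_density (f : T -> R) : measurable_fun setT f ->
  \int[nu]_x (f x)%:E = \int[mu]_x (f x * w x)%:E.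
Proof.
move=> mf; rewrite integralE [RHS]integralE.
have mEf : measurable_fun setT (EFin \o f) by exact/measurable_EFinP.
rewrite (ge0_integral_density (measurable_funepos mEf))//.
rewrite (ge0_integral_density (measurable_funeneg mEf))//.
congr (_ - _); apply: eq_integral => x _.
  by rewrite !funeposE -!EFin_max -EFinM maxr_pMl// mul0r.
by rewrite !funenegE -!EFinN -!EFin_max -EFinM maxr_pMl// mul0r mulNr.
Qed.

End density.

(** * Measure-preserving maps *)

Definition measure_preserving d (T : measurableType d) (R : realType)
    (mu : set T -> \bar R) (phi : T -> T) : Prop :=
  measurable_fun setT phi /\
  forall A, measurable A -> mu (phi @^-1` A) = mu A.

Section measure_preserving.
Context d (T : measurableType d) (R : realType).
Variable mu : {measure set T -> \bar R}.
Local Open Scope ereal_scope.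

Lemma measure_preserving_comp phi psi : measure_preserving mu phi ->
  measure_preserving mu psi -> measure_preserving mu (phi \o psi).
Proof.
move=> [mphi hphi] [mpsi hpsi]; split; first exact: measurableT_comp.
move=> A mA; rewrite comp_preimage hpsi ?hphi//.
by rewrite -[X in measurable X]setTI; exact: mphi.
Qed.

Lemma measure_preserving_id : measure_preserving mu id.
Proof. by split. Qed.

Lemma measure_preserving_ge0_integral phi (f : T -> \bar R) :
  measure_preserving mu phi -> measurable_fun setT f -> (forall x, 0 <= f x) ->
  \int[mu]_x f (phi x) = \int[mu]_x f x.
Proof.
move=> [mphi hphi] mf f0.
rewrite -[LHS](@ge0_integral_pushforward _ _ _ _ _ _ mphi mu setT f)//.
pose mphi_mixin := isMeasurableFun.Build _ _ _ _ _ mphi.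
pose mphi_pack : {mfun _ >-> _} := HB.pack phi mphi_mixin.
rewrite -[pushforward mu phi]/(pushforward mu mphi_pack).
by apply: (eq_measure_integral mu) => A mA _; exact: hphi.
Qed.

Lemma measure_preserving_integrable phi (f : T -> R) :
  measure_preserving mu phi -> measurable_fun setT f ->
  mu.-integrable setT (EFin \o f) ->
  mu.-integrable setT (fun x => (f (phi x))%:E).
Proof.
move=> hphi mf /integrableP[_ fi]; apply/integrableP; split.
  by apply/measurable_EFinP; apply: measurableT_comp => //; case: hphi.
rewrite (measure_preserving_ge0_integral (f := fun x => `|(f x)%:E|))//.
by apply: measurableT_comp => //; exact/measurable_EFinP.
Qed.

Lemma measure_preserving_integral phi (f : T -> R) :
  measure_preserving mu phi -> measurable_fun setT f ->
  \int[mu]_x (f (phi x))%:E = \int[mu]_x (f x)%:E.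
Proof.
move=> hphi mf; rewrite integralE [RHS]integralE.
have mEf : measurable_fun setT (EFin \o f) by exact/measurable_EFinP.
congr (_ - _).
  rewrite -[RHS](measure_preserving_ge0_integral hphi (measurable_funepos mEf))//.
  by apply: eq_integral => x _; rewrite !funeposE.
rewrite -[RHS](measure_preserving_ge0_integral hphi (measurable_funeneg mEf))//.
by apply: eq_integral => x _; rewrite !funenegE.
Qed.

End measure_preserving.

Lemma measure_preserving_pushforward d d' (T : measurableType d)
    (T' : measurableType d') (R : realType) (mu : set T -> \bar R)
    (f : T -> T') (psi : T -> T) (phi : T' -> T') :
  measurable_fun setT f -> measurable_fun setT phi ->
  (forall x, f (psi x) = phi (f x)) ->
  measure_preserving mu psi -> measure_preserving (pushforward mu f) phi.
Proof.
move=> mf mphi E [mpsi hpsi]; split => // A mA; rewrite /pushforward.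
rewrite -[RHS]hpsi; last by rewrite -[X in measurable X]setTI; exact: mf.
by congr mu; apply/seteqP; split => x /=; rewrite E.
Qed.

Section measure_preserving_prod.
Context d1 d2 (T1 : measurableType d1) (T2 : measurableType d2) (R : realType).
Variable m1 : {sigma_finite_measure set T1 -> \bar R}.
Variable m2 : {sigma_finite_measure set T2 -> \bar R}.
Local Open Scope ereal_scope.

(** The section at [x] of the preimage of [A] is the preimage under [psi x] of the section of [A] at
    [phi x]. Letting [psi] depend on [x] covers shears as well as product maps. *)
Lemma measure_preserving_skew (phi : T1 -> T1) (psi : T1 -> T2 -> T2) :
  measure_preserving m1 phi ->
  measurable_fun setT (fun p : T1 * T2 => psi p.1 p.2) ->
  (forall x, measure_preserving m2 (psi x)) ->
  measure_preserving (m1 \x m2) (fun p => (phi p.1, psi p.1 p.2)).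
Proof.
move=> hphi mpsi hpsi.
split.
  apply: measurable_fun_pair => //.
  by apply: measurableT_comp => //; case: hphi.
move=> A mA; rewrite /product_measure1.
rewrite -(measure_preserving_ge0_integral hphi (f := m2 \o xsection A))//.
  apply: eq_integral => x _ /=.
  rewrite -(proj2 (hpsi x) (xsection A (phi x))); last exact: measurable_xsection.
  by congr (m2 _); apply/seteqP; split => y; rewrite /xsection /= !inE.
exact: measurable_fun_xsection.
Qed.

End measure_preserving_prod.

(** The image measure agrees with the product measure on rectangles, which determine it. *)
Lemma measure_preserving_swap d (T : measurableType d) (R : realType)
    (m : {sigma_finite_measure set T -> \bar R}) :
  measure_preserving (m \x m)%E (fun p : T * T => (p.2, p.1)).
Proof.
have ms : measurable_fun setT (fun p : T * T => (p.2, p.1)).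
  exact: measurable_fun_pair.
split => // A mA.
pose mixin := isMeasurableFun.Build _ _ _ _ _ ms.
pose pack : {mfun _ >-> _} := HB.pack (fun p : T * T => (p.2, p.1)) mixin.
rewrite [RHS](@product_measure_unique _ _ _ _ _ m m (pushforward (m \x m)%E pack))//.
move=> B C mB mC.
rewrite -[LHS]/((m \x m)%E ((fun p : T * T => (p.2, p.1)) @^-1` (B `*` C))).
rewrite (_ : _ @^-1` _ = C `*` B); last first.
  by apply/seteqP; split => -[x y] /= [].
by rewrite product_measure1E// muleC.
Qed.

(** * Translations and rotations of the plane, of [C] and of [C^n] *)

Section lebesgue_preserving.
Variable R : realType.
Local Notation mu := (@lebesgue_measure R).

Lemma lebesgue_measure_translation (a : R) :
  measure_preserving mu (fun x : measurableTypeR R => (x + a : measurableTypeR R)).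
Proof.
have mt : measurable_fun setT
    (fun x : measurableTypeR R => (x + a : measurableTypeR R)).
  exact: measurable_funD.
split=> // A mA.
pose mixin := isMeasurableFun.Build _ _ _ _ _ mt.
pose pack : {mfun _ >-> _} := HB.pack
  (fun x : measurableTypeR R => (x + a : measurableTypeR R)) mixin.
apply/esym; apply: (@lebesgue_measure_unique R (pushforward mu pack)) => //.
move=> _ [[u v] _ <-] /=; rewrite /pushforward.
rewrite (_ : _ @^-1` _ = `]u - a, v - a]%classic); last first.
  by apply/seteqP; split => x /=; rewrite !in_itv /= ltrBlDr lerBrDr.
rewrite !lebesgue_measure_itv /= !lte_fin ltrD2r.
by case: ifP => // _; rewrite -!EFinD; congr (_%:E); ring.
Qed.

Lemma measure_preserving_shear (t : R) : measure_preserving (mu \x mu)%E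
  (fun p : measurableTypeR R * measurableTypeR R =>
     (p.1, p.2 + t * p.1) : measurableTypeR R * measurableTypeR R).
Proof.
apply: (@measure_preserving_skew _ _ _ _ R mu mu id (fun x y => y + t * x)).
- exact: measure_preserving_id.
- apply: measurable_funD; first exact: measurable_snd.
  apply: measurable_funM => //; exact: measurable_fst.
- move=> x; exact: lebesgue_measure_translation.
Qed.

Lemma measure_preserving_shear_swap (t : R) : measure_preserving (mu \x mu)%E
  (fun p : measurableTypeR R * measurableTypeR R =>
     (p.1 + t * p.2, p.2) : measurableTypeR R * measurableTypeR R).
Proof.
have s := @measure_preserving_swap _ _ _ mu.
exact: (measure_preserving_comp s
  (measure_preserving_comp (measure_preserving_shear t) s)).
Qed.

(* A rotation is a product of three shears, except for the half-turn. *)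
Lemma measure_preserving_rotation (a b : R) : a ^+ 2 + b ^+ 2 = 1 ->
  measure_preserving (mu \x mu)%E
  (fun p : measurableTypeR R * measurableTypeR R =>
    (a * p.1 - b * p.2, b * p.1 + a * p.2) : measurableTypeR R * measurableTypeR R).
Proof.
have gen c s : c ^+ 2 + s ^+ 2 = 1 -> 1 + c != 0 -> measure_preserving (mu \x mu)%E
  (fun p : measurableTypeR R * measurableTypeR R =>
    (c * p.1 - s * p.2, s * p.1 + c * p.2) : measurableTypeR R * measurableTypeR R).
  (* [t] is minus the tangent of half the angle; the three shears have parameters [t], [s], [t]. *)
  move=> cs c1; pose t := - s / (1 + c).
  have := measure_preserving_comp (measure_preserving_shear_swap t)
    (measure_preserving_comp (measure_preserving_shear s)
       (measure_preserving_shear_swap t)).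
  congr measure_preserving; apply/funext => -[x y] /=.
  have s2 : s ^+ 2 = (1 - c) * (1 + c) by lra.
  have ts : t * s = c - 1.
    by rewrite /t mulrAC mulNr -expr2 s2 mulNr mulfK//; ring.
  have tc : t * (1 + c) = - s by rewrite /t divfK.
  congr (_, _); last by rewrite mulrDr mulrA (mulrC s t) ts; ring.
  transitivity (x + (t * s) * x + (t * (1 + c) + (t * s - (c - 1)) * t) * y).
    by ring.
  by rewrite ts tc; ring.
(* The half-turn, where the tangent is infinite, is the square of a quarter-turn. *)
move=> ab; have [a1|a1] := eqVneq (1 + a) 0; last exact: gen.
have am1 : a = -1 by lra.
have b0 : b = 0.
  apply/eqP; rewrite -sqrf_eq0; apply/eqP; move: ab; rewrite am1 sqrrN expr1n; lra.
have q : measure_preserving (mu \x mu)%E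
  (fun p : measurableTypeR R * measurableTypeR R =>
    (0 * p.1 - 1 * p.2, 1 * p.1 + 0 * p.2) : measurableTypeR R * measurableTypeR R).
  by apply: gen; rewrite ?addr0 ?oner_neq0// expr0n expr1n add0r.
have := measure_preserving_comp q q; congr measure_preserving.
by apply/funext => -[x y] /=; rewrite am1 b0; congr (_, _); ring.
Qed.

Local Notation lc := (@lebesgue_complex R).

Lemma measurable_fun_complex d (T : measurableType d) (f : T -> R[i]) :
  measurable_fun setT (fun x => complex.Re (f x) : measurableTypeR R) ->
  measurable_fun setT (fun x => complex.Im (f x) : measurableTypeR R) ->
  measurable_fun setT f.
Proof.
move=> mre mim.
rewrite (_ : f = @complex_of_pair R \o (fun x => (complex.Re (f x), complex.Im (f x)))).
  apply: measurableT_comp; first exact: measurable_complex_of_pair.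
  exact: measurable_fun_pair.
by apply/funext => x /=; case: (f x).
Qed.

Lemma measurable_complexM d (T : measurableType d) (f g : T -> R[i]) :
  measurable_fun setT f -> measurable_fun setT g ->
  measurable_fun setT (fun x => f x * g x).
Proof.
move=> mf mg.
have mre h : measurable_fun setT h ->
    measurable_fun setT (fun x : T => complex.Re (h x) : measurableTypeR R).
  by move=> mh; exact: (measurableT_comp (@measurable_Re R) mh).
have mim h : measurable_fun setT h ->
    measurable_fun setT (fun x : T => complex.Im (h x) : measurableTypeR R).
  by move=> mh; exact: (measurableT_comp (@measurable_Im R) mh).
apply: measurable_fun_complex.
- have := measurable_funB (measurable_funM (mre _ mf) (mre _ mg))
    (measurable_funM (mim _ mf) (mim _ mg)).
  by congr measurable_fun; apply/funext => x /=; case: (f x); case: (g x).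
- have := measurable_funD (measurable_funM (mre _ mf) (mim _ mg))
    (measurable_funM (mim _ mf) (mre _ mg)).
  by congr measurable_fun; apply/funext => x /=; case: (f x); case: (g x).
Qed.

Lemma measurable_complexD d (T : measurableType d) (f g : T -> R[i]) :
  measurable_fun setT f -> measurable_fun setT g ->
  measurable_fun setT (fun x => f x + g x).
Proof.
move=> mf mg; apply: measurable_fun_complex.
- have := measurable_funD (measurableT_comp (@measurable_Re R) mf)
                           (measurableT_comp (@measurable_Re R) mg).
  by congr measurable_fun; apply/funext => x /=; case: (f x); case: (g x).
- have := measurable_funD (measurableT_comp (@measurable_Im R) mf)
                           (measurableT_comp (@measurable_Im R) mg).
  by congr measurable_fun; apply/funext => x /=; case: (f x); case: (g x).
Qed.

Lemma measure_preserving_complex_rotation (c : R[i]) : normc c = 1 ->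
  measure_preserving lc (fun z => c * z).
Proof.
case: c => a b /= ab.
apply: (measure_preserving_pushforward (@measurable_complex_of_pair R) _ _
   (measure_preserving_rotation (a := a) (b := b) _)).
- exact: measurable_complexM.
- move=> [x y]; apply/eqP; rewrite eq_complex /= eqxx /=; apply/eqP.
  by rewrite addrC.
- have /sqr_sqrtr : 0 <= a ^+ 2 + b ^+ 2 by rewrite addr_ge0 ?sqr_ge0.
  by rewrite ab expr1n.
Qed.

Lemma measure_preserving_complex_translation (c : R[i]) :
  measure_preserving lc (fun z => z + c).
Proof.
apply: (measure_preserving_pushforward (@measurable_complex_of_pair R)
   (psi := fun p : measurableTypeR R * measurableTypeR R =>
     (p.1 + complex.Re c, p.2 + complex.Im c)
       : measurableTypeR R * measurableTypeR R)).
- exact: measurable_complexD.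
- by case: c => a b [x y].
- apply: (@measure_preserving_skew _ _ _ _ R mu mu
    (fun x => x + complex.Re c) (fun x y => y + complex.Im c)).
  + exact: lebesgue_measure_translation.
  + by apply: measurable_funD => //; exact: measurable_snd.
  + by move=> x; exact: lebesgue_measure_translation.
Qed.

Lemma measure_preserving_cons n (phi : R[i] -> R[i])
    (psi : 'rV[R[i]]_n -> 'rV[R[i]]_n) (Phi : 'rV[R[i]]_n.+1 -> 'rV[R[i]]_n.+1) :
  measure_preserving lc phi -> measure_preserving (lebesgue_Cn R n) psi ->
  measurable_fun setT Phi ->
  (forall x v, cons_rV (phi x, psi v) = Phi (cons_rV (x, v))) ->
  measure_preserving (lebesgue_Cn R n.+1) Phi.
Proof.
move=> hphi hpsi mPhi E.
apply: (measure_preserving_pushforward (@measurable_cons_rV _ _ _)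
   (psi := fun p => (phi p.1, psi p.2)) mPhi).
  by move=> [x v]; exact: E.
apply: (@measure_preserving_skew _ _ _ _ R lc (lebesgue_Cn R n) phi (fun=> psi)) => //.
by apply: measurableT_comp => //; case: hpsi.
Qed.

Lemma cons_rV0 n (p : R[i] * 'rV[R[i]]_n) : cons_rV p ord0 ord0 = p.1.
Proof. by rewrite /cons_rV mxE; case: splitP => // j _; rewrite mxE. Qed.

Lemma cons_rVS n (p : R[i] * 'rV[R[i]]_n) i : cons_rV p ord0 (lift ord0 i) = p.2 ord0 i.
Proof.
rewrite /cons_rV (_ : lift ord0 i = rshift 1 i :> 'I_(1 + n)); last exact: val_inj.
by rewrite (@row_mxEr _ 1 1 n).
Qed.

Lemma measure_preserving_Cn_rotation n (c : R[i]) : normc c = 1 ->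
  measure_preserving (lebesgue_Cn R n) (fun v => c *: v).
Proof.
move=> c1.
have mc m : measurable_fun setT (fun v : 'rV[R[i]]_m => c *: v).
  apply: measurable_fun_rV => i; under eq_fun do rewrite mxE.
  by apply: measurable_complexM => //; exact: measurable_rV_coord.
elim: n => [|n IH].
  split=> [|A mA]; [exact: mc|rewrite (_ : _ @^-1` A = A)//].
  by apply/seteqP; split => x /=; rewrite [c *: x]thinmx0 [x]thinmx0.
apply: (measure_preserving_cons (measure_preserving_complex_rotation c1) IH) => //.
move=> x v; apply/rowP => i; rewrite [RHS]mxE.
by case: (unliftP ord0 i) => [j|] ->; rewrite ?cons_rV0 ?cons_rVS//= mxE.
Qed.

Lemma measure_preserving_Cn_translation n (a : 'rV[R[i]]_n) :
  measure_preserving (lebesgue_Cn R n) (fun v => v + a).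
Proof.
have mc m (b : 'rV[R[i]]_m) : measurable_fun setT (fun v : 'rV[R[i]]_m => v + b).
  apply: measurable_fun_rV => i; under eq_fun do rewrite mxE.
  by apply: measurable_complexD => //; exact: measurable_rV_coord.
elim: n a => [|n IH] a.
  split=> [|A mA]; [exact: mc|rewrite (_ : _ @^-1` A = A)//].
  by apply/seteqP; split => x /=; rewrite [x + a]thinmx0 [x]thinmx0.
apply: (measure_preserving_cons
  (measure_preserving_complex_translation (a ord0 ord0))
  (IH (\row_i a ord0 (lift ord0 i)))) => //.
move=> x v; apply/rowP => i; rewrite [RHS]mxE.
by case: (unliftP ord0 i) => [j|] ->; rewrite ?cons_rV0 ?cons_rVS//= !mxE.
Qed.

End lebesgue_preserving.

(** * Gaussian integrals on C^n *)

Section gaussian_Cn.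
Variable R : realType.
Local Notation mu := (@lebesgue_measure R).
Local Notation lc := (@lebesgue_complex R).

(** The integrand is a multiple of the centered normal density of variance [1 / (2 c)]. *)
Lemma integral_expR_sqr (c : R) : 0 < c ->
  (\int[mu]_x (expR (- (c * x ^+ 2)))%:E = (Num.sqrt (pi / c))%:E)%E.
Proof.
move=> c0; pose s := Num.sqrt ((2 * c)^-1).
have c20 : 0 < (2 * c)^-1 by rewrite invr_gt0 mulr_gt0.
have s0 : 0 < s by rewrite sqrtr_gt0.
have ssq : s ^+ 2 = (2 * c)^-1 by rewrite sqr_sqrtr// ltW.
have pk0 := normal_peak_gt0 (lt0r_neq0 s0).
have E x : expR (- (c * x ^+ 2)) = (normal_peak s)^-1 * normal_pdf 0 s x.
  rewrite normal_pdfE ?gt_eqF//= mulKf ?gt_eqF// /normal_fun subr0 ssq.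
  by congr expR; field; rewrite gt_eqF.
under eq_integral do rewrite E EFinM.
rewrite integralZl//; last exact: integrable_normal_pdf.
rewrite integral_normal_pdf mule1 /normal_peak invrK ssq; congr (Num.sqrt _)%:E.
by rewrite -mulr_natl; field; rewrite gt_eqF.
Qed.

Lemma ge0_integral_complex (f : R[i] -> \bar R) : measurable_fun setT f ->
  (forall z, 0 <= f z)%E ->
  (\int[lc]_z f z = \int[mu]_x \int[mu]_y f (x +i* y))%E.
Proof.
move=> mf f0.
rewrite [LHS](ge0_integral_pushforward (@measurable_complex_of_pair R))//.
rewrite preimage_setT fubini_tonelli1//; last by move=> p; exact: f0.
exact: (measurableT_comp mf (@measurable_complex_of_pair R)).
Qed.

Lemma ge0_integral_Cn n (f : 'rV[R[i]]_n.+1 -> \bar R) : measurable_fun setT f ->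
  (forall z, 0 <= f z)%E ->
  (\int[lebesgue_Cn R n.+1]_z f z =
   \int[lc]_x \int[lebesgue_Cn R n]_v f (cons_rV (x, v)))%E.
Proof.
move=> mf f0.
rewrite [LHS](ge0_integral_pushforward (@measurable_cons_rV _ _ _))//.
rewrite preimage_setT fubini_tonelli1//; last by move=> p; exact: f0.
exact: (measurableT_comp mf (@measurable_cons_rV _ _ _)).
Qed.

Lemma normsq_cons n (x : R[i]) (v : 'rV[R[i]]_n) :
  normsq (cons_rV (x, v)) =
  complex.Re x ^+ 2 + complex.Im x ^+ 2 + normsq v.
Proof.
rewrite !normsqE big_ord_recl cons_rV0; congr (_ + _).
by apply: eq_bigr => i _; rewrite cons_rVS.
Qed.

Lemma measurable_expR_normsq n (c : R) :
  measurable_fun setT (fun z : 'rV[R[i]]_n => expR (- (c * normsq z))).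
Proof.
apply: measurableT_comp => //; apply: measurable_funN.
by apply: measurable_funM => //; exact: measurable_normsq.
Qed.

Lemma integral_expR_normsq n (c : R) : 0 < c ->
  (\int[lebesgue_Cn R n]_z (expR (- (c * normsq z)))%:E = ((pi / c) ^+ n)%:E)%E.
Proof.
move=> c0; have pc0 : 0 <= pi / c by rewrite divr_ge0 ?pi_ge0 ?ltW.
have mE m : measurable_fun setT (fun z : 'rV[R[i]]_m => (expR (- (c * normsq z)))%:E).
  by apply/measurable_EFinP; exact: measurable_expR_normsq.
have mRe : measurable_fun setT
    (fun x : R[i] => expR (- (c * (complex.Re x ^+ 2 + complex.Im x ^+ 2)))).
  apply: measurableT_comp => //; apply: measurable_funN.
  apply: measurable_funM => //; apply: measurable_funD; apply: measurable_funX.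
    exact: measurable_Re.
  exact: measurable_Im.
elim: n => [|n IH].
  rewrite /= integral_dirac//; last exact: mE.
  rewrite [X in (X * _)%E](_ : _ = 1%E); last by rewrite /= /dirac indicE mem_set.
  by rewrite mul1e /= normsqE big_ord0 mulr0 oppr0 expR0 expr0.
rewrite ge0_integral_Cn//.
under eq_integral => x _.
  under eq_integral do rewrite normsq_cons mulrDr opprD expRD EFinM.
  rewrite ge0_integralZl//; last exact: mE.
  rewrite IH.
  over.
rewrite ge0_integralZr//; last 2 first.
- exact/measurable_EFinP.
- by rewrite lee_fin exprn_ge0.
rewrite exprS EFinM; congr (_ * _)%E.
rewrite ge0_integral_complex//; last exact/measurable_EFinP.
have mx : measurable_fun setT (fun x : measurableTypeR R => (expR (- (c * x ^+ 2)))%:E).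
  apply/measurable_EFinP; apply: measurableT_comp => //; apply: measurable_funN.
  by apply: measurable_funM => //; exact: measurable_funX.
under eq_integral => x _.
  under eq_integral do rewrite /= mulrDr opprD expRD EFinM.
  rewrite ge0_integralZl//.
  rewrite integral_expR_sqr//.
  over.
rewrite ge0_integralZr//.
by rewrite integral_expR_sqr// -EFinM -expr2 sqr_sqrtr.
Qed.

Lemma integrable_expR_normsq n (c a : R) : 0 < c ->
  (lebesgue_Cn R n).-integrable setT (fun z => (a * expR (- (c * normsq z)))%:E).
Proof.
move=> c0; under eq_fun do rewrite EFinM.
apply: integrableZl => //; apply/integrableP; split.
  by apply/measurable_EFinP; exact: measurable_expR_normsq.
under eq_integral do rewrite /= ger0_norm ?expR_ge0//.
by rewrite integral_expR_normsq// ltry.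
Qed.

Lemma ae_le_integrable d (T : measurableType d) (m : {measure set T -> \bar R})
    (f g : T -> R) : measurable_fun setT f ->
  {ae m, forall x, `|f x| <= g x} -> m.-integrable setT (EFin \o g) ->
  m.-integrable setT (EFin \o f).
Proof.
move=> mf fg /integrableP[mg gi]; apply/integrableP; split.
  exact/measurable_EFinP.
apply: le_lt_trans gi; apply: ae_ge0_le_integral => //.
- by apply: measurableT_comp => //; exact/measurable_EFinP.
- by apply: measurableT_comp.
- apply: filterS fg => x fgx _ /=; rewrite lee_fin.
  by rewrite (le_trans fgx)// ler_norm.
Qed.

Lemma ae_measure_preserving d (T : measurableType d) (m : {measure set T -> \bar R})
    (phi : T -> T) (P : T -> Prop) : measure_preserving m phi ->
  {ae m, forall x, P x} -> {ae m, forall x, P (phi x)}.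
Proof.
move=> [mphi hphi] [N [mN N0 PN]]; exists (phi @^-1` N); split.
- by rewrite -[X in measurable X]setTI; exact: mphi.
- by rewrite hphi.
- by move=> x /= nP; apply: PN.
Qed.

(** The Euclidean inner product of [C^n] seen as [R^2n]. *)
Definition rdot n (w z : 'rV[R[i]]_n) : R := complex.Re (bdot w (conjv z)).

Lemma rdotE n (w z : 'rV[R[i]]_n) : rdot w z =
  \sum_(k < n) (complex.Re (w ord0 k) * complex.Re (z ord0 k) +
                complex.Im (w ord0 k) * complex.Im (z ord0 k)).
Proof.
rewrite /rdot /bdot raddf_sum; apply: eq_bigr => k _; rewrite mxE.
by case: (w ord0 k) => a b; case: (z ord0 k) => a' b' /=; rewrite mulrN opprK.
Qed.

Lemma normsqD n (w z : 'rV[R[i]]_n) :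
  normsq (w + z) = normsq w + 2 * rdot w z + normsq z.
Proof.
rewrite !normsqE rdotE mulr_sumr -!big_split /=; apply: eq_bigr => k _.
rewrite mxE; case: (w ord0 k) => a b; case: (z ord0 k) => a' b' /=; ring.
Qed.

(** Young's inequality, from [(e * x - y) ^+ 2 >= 0] in each real coordinate. *)
Lemma rdot_le n (e : R) (w z : 'rV[R[i]]_n) : 0 < e ->
  2 * rdot w z <= e * normsq w + e^-1 * normsq z.
Proof.
move=> e0; rewrite !normsqE rdotE !mulr_sumr -big_split ler_sum//= => k _.
case: (w ord0 k) => a b; case: (z ord0 k) => a' b' /=.
have H x y : 2 * (x * y) <= e * x ^+ 2 + e^-1 * y ^+ 2.
  rewrite -subr_ge0 (_ : _ - _ = e^-1 * (e * x - y) ^+ 2).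
    by rewrite mulr_ge0 ?invr_ge0 ?sqr_ge0// ltW.
  by field; rewrite gt_eqF.
have := H a a'; have := H b b'; lra.
Qed.

Lemma normsqD_le n (w z : 'rV[R[i]]_n) :
  normsq (w + z) <= 2 * normsq w + 2 * normsq z.
Proof.
by rewrite normsqD; have := @rdot_le n 1 w z ltr01; rewrite invr1; lra.
Qed.

Lemma Sym_ae_le n (g : 'rV[R[i]]_n -> R[i]) (c : R) : Sym g -> 0 < c ->
  exists M : R, {ae lebesgue_Cn R n, forall z, normc (g z) <= M * expR (c * normsq z)}.
Proof.
move=> [mg gb] c0; have [_ gc] := gb c c0.
have E z : normc (g z * (expR (- (c * normsq z)))%:C) =
    normc (g z) * expR (- (c * normsq z)).
  by rewrite Normc.normcM /= expr0n addr0 sqrtr_sqr ger0_norm ?expR_ge0.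
suff [M HM] : exists M, {ae lebesgue_Cn R n, forall z,
    normc (g z * (expR (- (c * normsq z)))%:C) <= M}.
  exists M; apply: filterS HM => z; rewrite E expRN.
  by rewrite ler_pdivrMr ?expR_gt0.
move: gc; rewrite /finite_norm unlock; case: ifPn => [m0 h|m0 _].
  have [M HM] := @ess_supr_bounded _ _ _ _
    (fun z => `|normc (g z * (expR (- (c * normsq z)))%:C)|) h.
  by exists M; apply: filterS HM => z; apply: le_trans; rewrite ler_norm.
(* This is the default case of the supremum norm, for a space of measure 0; there everything holds
   almost everywhere. *)
exists 0; exists setT; split => //.
by apply/eqP; rewrite eq_le measure_ge0 andbT leNgt.
Qed.

(** A common criterion for the Berezin integrand of the explicit solution ([p = - one]) and for its
    recentered form ([p = z]). *)
Lemma Sym_integrable n (g : 'rV[R[i]]_n -> R[i]) (p s : 'rV[R[i]]_n)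
    (f : 'rV[R[i]]_n -> R) : Sym g -> measurable_fun setT f ->
  (forall w, `|f w| <= normc (g (w + p)) * expR (2 * rdot w s - normsq w)) ->
  (lebesgue_Cn R n).-integrable setT (EFin \o f).
Proof.
(* With [1 / 8] the translated bound on [g] costs [|w|^2 / 4]; the linear exponential costs as much
   by Young's inequality, and [exp (- |w|^2 / 2)] is left. *)
move=> Sg mf fg; have c0 : 0 < (1 / 8 : R) by rewrite divr_gt0.
have [M HM] := Sym_ae_le Sg c0.
have M0 : {ae lebesgue_Cn R n, forall w : 'rV[R[i]]_n, normc (g (w + p)) <=
    `|M| * expR (1 / 8 * normsq (w + p))}.
  have := ae_measure_preserving (measure_preserving_Cn_translation p) HM.
  apply: filterS => w /le_trans; apply; rewrite ler_wpM2r ?expR_ge0//.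
  exact: ler_norm.
apply: (@ae_le_integrable _ _ (lebesgue_Cn R n) f (fun w =>
   `|M| * expR (1 / 4 * normsq p + 4 * normsq s) * expR (- (1 / 2 * normsq w)))) => //.
  apply: filterS M0 => w Mw; apply: (le_trans (fg w)).
  apply: (@le_trans _ _ (`|M| * expR (1 / 8 * normsq (w + p)) *
     expR (2 * rdot w s - normsq w))).
    by rewrite ler_wpM2r ?expR_ge0.
  rewrite -!mulrA ler_wpM2l// -!expRD ler_expR.
  have := normsqD_le w p; have := @rdot_le n (1 / 4) w s (ltac:(lra)).
  rewrite div1r invrK; lra.
by apply: integrable_expR_normsq; rewrite divr_gt0.
Qed.

End gaussian_Cn.

(** * The Gaussian mean value property *)

Section gaussian_mean_value.
Variables (R : realType) (n : nat).
Local Notation mu := (@lebesgue_measure R).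
Local Notation lC := (lebesgue_Cn R n).

Lemma normc_cexp_i (t : R) : normc (cexp (0 +i* t)) = 1.
Proof.
by rewrite /cexp /= expR0 !mul0r subr0 addr0 !mul1r cos2Dsin2 sqrtr1.
Qed.

Lemma normsqZ (c : R[i]) (z : 'rV[R[i]]_n) :
  normsq (c *: z) = normc c ^+ 2 * normsq z.
Proof.
rewrite !normsqE mulr_sumr; apply: eq_bigr => k _; rewrite mxE.
case: c => a b; case: (z ord0 k) => x y /=.
by rewrite sqr_sqrtr ?addr_ge0 ?sqr_ge0//; ring.
Qed.

(** Joint measurability in the angle and the point is what Fubini's theorem requires. *)
Lemma measurable_rotation_action :
  measurable_fun setT (fun p : measurableTypeR R * 'rV[R[i]]_n =>
    cexp (0 +i* p.1) *: p.2).
Proof.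
apply: measurable_fun_rV => i; under eq_fun do rewrite mxE.
apply: measurable_complexM; last first.
  exact: (measurableT_comp (@measurable_rV_coord _ _ _ i) measurable_snd).
have mc : measurable_fun setT (fun t : measurableTypeR R => cexp (0 +i* t)).
  apply: measurable_fun_complex.
  - rewrite (_ : (fun _ => _) = @cos R).
      by apply: continuous_measurable_fun; exact: continuous_cos.
    by apply/funext => t; rewrite /cexp /= expR0 mul0r subr0 mul1r.
  - rewrite (_ : (fun _ => _) = @sin R).
      by apply: continuous_measurable_fun; exact: continuous_sin.
    by apply/funext => t; rewrite /cexp /= expR0 mul0r addr0 mul1r.
exact: (measurableT_comp mc measurable_fst).
Qed.

(* Rotation invariance of the Gaussian lets one average over the rotations
   [z |-> e^{it} z]; the average of [H] over each orbit is [H 0]. *)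
Lemma gaussian_mean_value (H : 'rV[R[i]]_n -> R[i]) :
  (forall z, differentiable H z) -> measurable_fun setT H ->
  lC.-integrable setT
    (fun z => (complex.Re (H z) * gaussian_density z)%:E) ->
  (\int[lC]_z (complex.Re (H z) * gaussian_density z)%:E =
   (complex.Re (H 0))%:E)%E.
Proof.
move=> dH mH iH.
pose f z := complex.Re (H z) * gaussian_density z.
have mReH : measurable_fun setT (fun z => complex.Re (H z)).
  exact: (measurableT_comp (@measurable_Re R) mH).
have mf : measurable_fun setT f.
  by apply: measurable_funM => //; exact: measurable_gaussian_density.
have densZ t (z : 'rV[R[i]]_n) :
    gaussian_density (cexp (0 +i* t) *: z) = gaussian_density z.
  by rewrite /gaussian_density normsqZ normc_cexp_i expr1n mul1r.
have pi0 : 0 < (pi *+ 2 : R) by rewrite mulrn_wgt0// pi_gt0.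
pose D : set (measurableTypeR R) := `[0, pi *+ 2]%classic.
have mD : measurable D by exact: measurable_itv.
have muD : mu D = (pi *+ 2)%:E.
  by rewrite lebesgue_measure_itv/= lte_fin pi0 oppr0 adde0.
have iD : (\int[mu]_t (\1_D t)%:E = (pi *+ 2)%:E)%E.
  by rewrite integral_indic// setIT; exact: muD.
pose F (p : measurableTypeR R * 'rV[R[i]]_n) :=
  \1_D p.1 * f (cexp (0 +i* p.1) *: p.2).
have mF : measurable_fun setT (EFin \o F).
  apply/measurable_EFinP; apply: measurable_funM.
    by apply: measurableT_comp => //; exact: measurable_fst.
  by apply: measurableT_comp => //; exact: measurable_rotation_action.
have rot t := measure_preserving_Cn_rotation n (normc_cexp_i t).
(* By rotation invariance the inner integral of [|F|] is the same for all [t] in [D], so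
   integrability over the product reduces to [iH]. *)
have iF : (mu \x lC)%E.-integrable setT (EFin \o F).
  apply/integrable12ltyP => //.
  have mnf : measurable_fun setT (fun z => `|(f z)%:E|%E).
    by apply: measurableT_comp => //; exact/measurable_EFinP.
  have E t : (\int[lC]_z `|(EFin \o F) (t, z)| =
      (\1_D t)%:E * \int[lC]_z `|(f z)%:E|)%E.
    rewrite -(measure_preserving_ge0_integral (rot t) mnf)//.
    rewrite -ge0_integralZl//; last first.
      by apply: (measurableT_comp mnf); case: (rot t).
    by apply: eq_integral => z _; rewrite /F /= normrM ger0_norm.
  under eq_integral do rewrite E.
  rewrite ge0_integralZr//; last 2 first.
  - exact/measurable_EFinP.
  - exact: integral_ge0.
  rewrite iD.
  by move/integrableP : iH => [_ h]; rewrite lte_mul_pinfty// lee_fin ltW.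
have fin_I : (\int[lC]_z (f z)%:E)%E \is a fin_num by exact: integrable_fin_num.
have inner_z t : (\int[lC]_z (EFin \o F) (t, z) =
    (fine (\int[lC]_z (f z)%:E)%E)%:E * (\1_D t)%:E)%E.
  rewrite fineK// -(measure_preserving_integral (rot t) mf) muleC.
  rewrite -integralZl//.
  by apply: measure_preserving_integrable => //; exact: rot.
(* The density is constant on the orbit of [z], and the mean value property applies to the
   one-variable function [c |-> H (c *: z)]. *)
have inner_t z : (\int[mu]_t (EFin \o F) (t, z) =
    (gaussian_density z * (complex.Re (H 0) * (pi *+ 2)))%:E)%E.
  pose phi (c : R[i]) := H (c *: z).
  have dphi c : differentiable phi c.
    exact: (@differentiable_comp _ _ _ _ (fun c : R[i] => c *: z) H).
  have := circle_mean_value dphi; rewrite /phi scale0r => E.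
  have cphi : continuous (fun t : R => complex.Re (phi (cexp (0 +i* t)))).
    have PQ := closed_at_holomorphic (F := phi \o @cexp R) _.
    apply: (closed_field_continuousr (PQ _)) => c.
    by apply: differentiable_comp; [exact: differentiable_cexp|exact: dphi].
  have iphi : mu.-integrable `[0, pi *+ 2]
      (EFin \o (fun t : R => complex.Re (phi (cexp (0 +i* t))))).
    apply: continuous_compact_integrable; first exact: segment_compact.
    exact: continuous_subspaceT.
  rewrite -E EFinM -[X in (_ * X)%E]/((fine _)%:E).
  rewrite fineK; last exact: integrable_fin_num.
  rewrite -integralZl// [RHS]integral_mkcond; apply: eq_integral => t _.
  rewrite patchE /F /= indicE -/D; case: (t \in D).
    by rewrite mul1r /f densZ mulrC EFinM.
  by rewrite /= mul0r.
have := Fubini iF.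
under eq_integral do rewrite inner_z.
under [in RHS]eq_integral do rewrite inner_t mulrC EFinM.
rewrite integralZl//; last first.
  under eq_fun do rewrite /gaussian_density -[normsq _]mul1r.
  exact: integrable_expR_normsq.
rewrite integralZl//; last first.
  apply/integrableP; split; first exact/measurable_EFinP.
  under eq_integral do rewrite /= ger0_norm//.
  by rewrite iD ltry.
rewrite iD.
have -> : (\int[lC]_z (gaussian_density z)%:E = 1)%E.
  rewrite /gaussian_density.
  under eq_integral do rewrite EFinM -[normsq _]mul1r.
  rewrite ge0_integralZl//; last 2 first.
  - by apply/measurable_EFinP; exact: measurable_expR_normsq.
  - by rewrite lee_fin invr_ge0 exprn_ge0// pi_ge0.
  rewrite integral_expR_normsq// divr1 -EFinM mulVf//.
  by rewrite expf_neq0// gt_eqF// pi_gt0.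
rewrite mule1 -EFinM => -[] /(mulIf (lt0r_neq0 pi0)) <-.
by rewrite fineK.
Qed.

End gaussian_mean_value.

(** * The Berezin equation *)

Section fock_real.
Variables (R : realType) (n : nat).
Local Notation lC := (lebesgue_Cn R n).
Implicit Types (w z : 'rV[R[i]]_n).

Lemma normc_cexp (c : R[i]) : normc (cexp c) = expR (complex.Re c).
Proof.
case: c => a b; rewrite /cexp /= !mul0r subr0 addr0 !exprMn -mulrDr.
by rewrite cos2Dsin2 mulr1 sqrtr_sqr ger0_norm ?expR_ge0.
Qed.

Lemma bdot_conjv_norm z : bdot z (conjv z) = (normsq z)%:C.
Proof.
rewrite /normsq; apply/eqP; rewrite eq_complex /= eqxx /=; apply/eqP.
rewrite /bdot raddf_sum big1//= => k _; rewrite mxE.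
by case: (z ord0 k) => a b /=; ring.
Qed.

Lemma normalized_kernel_sqr w z : `|normalized_kernel w z| ^+ 2 =
  (expR (2 * rdot w z - normsq z))%:C.
Proof.
rewrite /normalized_kernel /fock_kernel bdot_conjv_norm.
have -> : cexp (normsq z)%:C = (expR (normsq z))%:C.
  rewrite /cexp /= cos0 sin0; apply/eqP; rewrite eq_complex /=.
  by apply/andP; split; apply/eqP; ring.
rewrite sqrtc_sqrtr; last by rewrite ler0c expR_ge0.
rewrite normcEC -rmorphXn; congr (_%:C).
rewrite Normc.normcM Normc.normcV normc_cexp -/(rdot w z) exprMn exprVn.
rewrite /= expr0n addr0 sqrtr_sqr (ger0_norm (sqrtr_ge0 _)).
rewrite sqr_sqrtr ?expR_ge0// -expRN -expRM_natl -expRD.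
by congr expR; rewrite mulr_natl.
Qed.

Lemma gaussian_density_gt0 w : 0 < gaussian_density w.
Proof. by rewrite mulr_gt0 ?expR_gt0// invr_gt0 exprn_gt0// pi_gt0. Qed.

Lemma gaussian_density_le w : gaussian_density w <= expR (- normsq w).
Proof.
rewrite /gaussian_density ler_piMl ?expR_ge0// invf_le1 ?exprn_gt0 ?pi_gt0//.
by rewrite exprn_ege1// (le_trans _ (pi_ge2 R))// ler1n.
Qed.

Lemma gaussian_measureE (A : set 'rV[R[i]]_n) : measurable A ->
  @gaussian_measure R n A = (\int[lC]_(z in A) (gaussian_density z)%:E)%E.
Proof. by []. Qed.

Lemma rdotDr w z z' : rdot w (z + z') = rdot w z + rdot w z'.
Proof.
rewrite !rdotE -big_split; apply: eq_bigr => k _ /=; rewrite mxE.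
by case: (z ord0 k) => a b; case: (z' ord0 k) => a' b' /=; ring.
Qed.

Lemma rdotDl w w' z : rdot (w + w') z = rdot w z + rdot w' z.
Proof.
rewrite !rdotE -big_split; apply: eq_bigr => k _ /=; rewrite mxE.
by case: (w ord0 k) => a b; case: (w' ord0 k) => a' b' /=; ring.
Qed.

Lemma rdotZr w z (a : R) : rdot w (a%:C *: z) = a * rdot w z.
Proof.
rewrite !rdotE mulr_sumr; apply: eq_bigr => k _ /=; rewrite mxE.
by case: (z ord0 k) => b b' /=; ring.
Qed.

Lemma measurable_rdot z : measurable_fun setT (fun w => rdot w z).
Proof.
under eq_fun do rewrite rdotE.
apply: (@measurable_sum _ _ _ _ _ _ (fun (k : 'I_n) w =>
  complex.Re (w ord0 k) * complex.Re (z ord0 k) +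
  complex.Im (w ord0 k) * complex.Im (z ord0 k))) => k.
apply: measurable_funD; apply: measurable_funM => //.
- exact: (measurableT_comp (@measurable_Re R) (measurable_rV_coord _)).
- exact: (measurableT_comp (@measurable_Im R) (measurable_rV_coord _)).
Qed.

(** All real linear forms on [C^n], parametrized so that their exponentials are those in
    [|normalized_kernel w z| ^+ 2]. *)
Definition rdot_forms : set ('rV[R[i]]_n -> R) :=
  [set L | exists z, L = (fun w => 2 * rdot w z)].

(** The real and imaginary parts of the coordinates are themselves such forms, so the identity is
    measurable from the sigma-algebra of half-spaces to the Borel one. *)
Lemma measurable_Cn_rdot_forms : measurable `<=`
  <<s [set A : set 'rV[R[i]]_n | exists L c,
         rdot_forms L /\ A = [set x | c < L x]] >>.
Proof.
set G := (X in <<s X >>).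
pose T := g_sigma_algebraType G.
have ray z : measurable_fun setT (fun w : T => 2 * rdot w z : measurableTypeR R).
  apply: (measurability _ (RGenOInfty.measurableE R)) => _ [_ [c ->] <-].
  rewrite setTI; apply: sub_sigma_algebra; exists (fun w => 2 * rdot w z), c.
  split; first by exists z.
  by apply/seteqP; split => w /=; rewrite in_itv/= andbT.
have cRe (k : 'I_n) : measurable_fun setT
      (fun w : T => complex.Re ((w : 'rV_n) ord0 k) : measurableTypeR R).
  (* The half compensates the factor 2 in the forms. *)
  have := ray (\row_j (if j == k then (2^-1)%:C else 0)).
  congr measurable_fun; apply/funext => w; rewrite rdotE (bigD1 k)//= mxE eqxx.
  rewrite big1; first by rewrite /= mulr0 !addr0 mulrCA mulfV ?mulr1// pnatr_eq0.
  by move=> j jk; rewrite mxE (negbTE jk) /= !mulr0 addr0.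
have cIm (k : 'I_n) : measurable_fun setT
      (fun w : T => complex.Im ((w : 'rV_n) ord0 k) : measurableTypeR R).
  have := ray (\row_j (if j == k then 0 +i* 2^-1 else 0)).
  congr measurable_fun; apply/funext => w; rewrite rdotE (bigD1 k)//= mxE eqxx.
  rewrite big1; first by rewrite /= mulr0 add0r addr0 mulrCA mulfV ?mulr1// pnatr_eq0.
  by move=> j jk; rewrite mxE (negbTE jk) /= !mulr0 addr0.
have mid : measurable_fun setT (fun w : T => (w : 'rV[R[i]]_n)).
  by apply: measurable_fun_rV => k; exact: measurable_fun_complex.
move=> A mA; have := mid measurableT A mA.
by rewrite setTI.
Qed.

Lemma measurable_bdot z : measurable_fun setT (fun w => bdot w z).
Proof.
have -> : (fun w => bdot w z) = \sum_(k < n) (fun w => w ord0 k * z ord0 k).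
  by apply/funext => w; rewrite fct_sumE.
elim/big_ind: _ => [|f g mf mg|k _]; first exact: measurable_cst.
- exact: measurable_complexD.
- by apply: measurable_complexM => //; exact: measurable_rV_coord.
Qed.

Lemma differentiable_bdot z w : differentiable (fun w => bdot w z) w.
Proof.
have -> : (fun w => bdot w z) = \sum_(k < n) (fun w => w ord0 k * z ord0 k).
  by apply/funext => v; rewrite fct_sumE.
apply: differentiable_sum => k; apply: differentiableM => //.
exact: differentiable_coord.
Qed.

Lemma measurable_cexp : measurable_fun setT (@cexp R).
Proof.
have mRe := @measurable_Re R; have mIm := @measurable_Im R.
apply: measurable_fun_complex.
- rewrite (_ : (fun _ => _) = (fun x => expR (complex.Re x) * cos (complex.Im x))).
    apply: measurable_funM; first exact: (measurableT_comp (@measurable_expR R)).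
    apply: (measurableT_comp _ mIm).
    by apply: continuous_measurable_fun; exact: continuous_cos.
  by apply/funext => x; rewrite /cexp /= mul0r subr0.
- rewrite (_ : (fun _ => _) = (fun x => expR (complex.Re x) * sin (complex.Im x))).
    apply: measurable_funM; first exact: (measurableT_comp (@measurable_expR R)).
    apply: (measurableT_comp _ mIm).
    by apply: continuous_measurable_fun; exact: continuous_sin.
  by apply/funext => x; rewrite /cexp /= mul0r addr0.
Qed.

Lemma measurable_conjc : measurable_fun setT (@conjc R).
Proof.
apply: measurable_fun_complex.
  rewrite (_ : (fun _ => _) = @complex.Re R); first exact: measurable_Re.
  by apply/funext => -[].
rewrite (_ : (fun _ => _) = (fun x => - complex.Im x)).
  by apply: measurable_funN; exact: measurable_Im.
by apply/funext => -[].
Qed.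

End fock_real.

(** Complex integrals are taken part by part; the boolean lets one argument serve both parts. *)
Definition cpart (R : realType) (b : bool) (x : R[i]) : R :=
  if b then complex.Re x else complex.Im x.

Section berezin_equation.
Variables (R : realType) (n : nat).
Local Notation lC := (lebesgue_Cn R n).
Local Notation dens := (@gaussian_density R n).
Implicit Types (w z : 'rV[R[i]]_n) (u g : 'rV[R[i]]_n -> R[i]).

Lemma cpartMr b (x : R[i]) (r : R) : cpart b (x * r%:C) = cpart b x * r.
Proof. by case: x b => x y [] /=; rewrite mulr0 ?subr0 ?add0r. Qed.

Lemma cpart_le b (x : R[i]) : `|cpart b x| <= normc x.
Proof. by case: b; [exact: normc_Re_le|exact: normc_Im_le]. Qed.

Lemma measurable_cpart b : measurable_fun setT (@cpart R b).
Proof. by case: b; [exact: measurable_Re|exact: measurable_Im]. Qed.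

(** Either part of an antilinear function is the real part of a linear one, which replaces the
    conjugate of [g] by [g]. *)
Lemma cpart_conjcE b (K : R[i]) :
  exists k, forall x, cpart b (K * conjc x) = complex.Re (k * x).
Proof.
case: K => p q; case: b; [exists (p -i* q)|exists (q +i* p)] => -[x y] /=; ring.
Qed.

Lemma cexp_real (r : R) : cexp r%:C = (expR r)%:C.
Proof.
by rewrite /cexp /= cos0 sin0; apply/eqP; rewrite eq_complex /= mulr1 mul0r
  subr0 mulr0 mul0r addr0 !eqxx.
Qed.

Lemma conjc_cexp (x : R[i]) : conjc (cexp x) = cexp (conjc x).
Proof.
case: x => x y; rewrite /cexp /= cosN sinN; apply/eqP; rewrite eq_complex /=.
by apply/andP; split; apply/eqP; ring.
Qed.

Lemma berezinE b u z : measurable_fun setT u -> cpart b (berezin u z) =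
  fine (\int[lC]_w (cpart b (u w) * expR (2 * rdot w z - normsq z) * dens w)%:E)%E.
Proof.
move=> mu.
have mf : measurable_fun setT
    (fun w => cpart b (u w) * expR (2 * rdot w z - normsq z)).
  apply: measurable_funM; first exact: (measurableT_comp (measurable_cpart b)).
  apply: measurableT_comp => //; apply: measurable_funB => //.
  by apply: measurable_funM => //; exact: measurable_rdot.
rewrite -(integral_density (mu := lC) (nu := @gaussian_measure R n)
  (@measurable_gaussian_density R n) (@gaussian_density_ge0 R n)
  (@gaussian_measureE R n) mf).
have E w : cpart b (u w * `|normalized_kernel w z| ^+ 2) =
    cpart b (u w) * expR (2 * rdot w z - normsq z).
  by rewrite normalized_kernel_sqr cpartMr.
rewrite /berezin /cintegral; case: b mf E => mf E /=;
  by congr fine; apply: eq_integral => w _; rewrite -E.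
Qed.

Lemma exponential_form_integrable z :
  lC.-integrable setT (fun w => (expR (2 * rdot w z) * dens w)%:E).
Proof.
have mr : measurable_fun setT (fun w => expR (2 * rdot w z)).
  apply: measurableT_comp => //.
  by apply: measurable_funM => //; exact: measurable_rdot.
apply: (@ae_le_integrable _ _ _ lC _
  (fun w => expR (2 * normsq z) * expR (- (1 / 2 * normsq w)))).
- by apply: measurable_funM => //; exact: measurable_gaussian_density.
- apply: aeW => w; rewrite ger0_norm; last first.
    by rewrite mulr_ge0 ?expR_ge0 ?gaussian_density_ge0.
  apply: (le_trans (ler_wpM2l (expR_ge0 _) (gaussian_density_le w))).
  rewrite -!expRD ler_expR.
  have := @rdot_le R n (1 / 2) w z (ltac:(lra)); rewrite div1r invrK; lra.
- by apply: integrable_expR_normsq; rewrite divr_gt0.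
Qed.

(** [|u| * e <= |u| ^+ 2 + e ^+ 2], where the square of the exponential at [z] is the exponential at
    [2 z]. *)
Lemma L2_integrable_form b u z : cLp (@gaussian_measure R n) 2%:E u ->
  lC.-integrable setT (fun w => (cpart b (u w) * expR (2 * rdot w z) * dens w)%:E).
Proof.
move=> [mu u2].
have mnu : measurable_fun setT (fun w => normc (u w)).
  rewrite (_ : (fun _ => _) = fun w =>
      Num.sqrt (complex.Re (u w) ^+ 2 + complex.Im (u w) ^+ 2)); last first.
    by apply/funext => w; case: (u w).
  apply: (measurableT_comp (continuous_measurable_fun (@sqrt_continuous R))).
  apply: measurable_funD; apply: measurable_funX.
    exact: (measurableT_comp (@measurable_Re R)).
  exact: (measurableT_comp (@measurable_Im R)).
have mr : measurable_fun setT (fun w => expR (2 * rdot w z)).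
  apply: measurableT_comp => //.
  by apply: measurable_funM => //; exact: measurable_rdot.
have mdens := @measurable_gaussian_density R n.
have iu : (@gaussian_measure R n).-integrable setT
    (EFin \o (fun w => normc (u w) ^+ 2)).
  apply: Lfun2_integrable_sqr; rewrite inE; apply/andP; split; rewrite inE/=.
    exact: mnu.
  exact: u2.
have := (integrable_density (mu := lC) mdens (@gaussian_density_ge0 R n)
  (@gaussian_measureE R n) (measurable_funX 2 mnu)).2 iu => {}iu.
have ie := exponential_form_integrable (2%:R%:C *: z).
have := integrableD measurableT iu ie.
apply: le_integrable => //.
  apply/measurable_EFinP; apply: measurable_funM => //; apply: measurable_funM => //.
  exact: (measurableT_comp (measurable_cpart b)).
move=> w _; rewrite /= lee_fin -mulrDl !normrM ler_wpM2r//.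
rewrite (ger0_norm (expR_ge0 _)) rdotZr.
rewrite (expRM_natl 2 (2 * rdot w z)).
set e := expR _; have e0 : 0 <= e := expR_ge0 _.
rewrite (ger0_norm (addr_ge0 (sqr_ge0 _) (sqr_ge0 _))).
apply: (@le_trans _ _ (normc (u w) * e)); first by rewrite ler_wpM2r ?cpart_le.
have := sqr_ge0 (normc (u w) - e); have := sqr_ge0 (normc (u w)).
have := sqr_ge0 e; rewrite sqrrB mulr2n; lra.
Qed.

Local Notation one := (const_mx 1 : 'rV[R[i]]_n).

Lemma conjv_one : conjv one = one.
Proof. by apply/rowP => i; rewrite !mxE conjc1. Qed.

Lemma Re_bdot_one z : complex.Re (bdot z one) = rdot z one.
Proof. by rewrite /rdot conjv_one. Qed.

Lemma bdotDl w z s : bdot (w + z) s = bdot w s + bdot z s.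
Proof.
by rewrite -big_split; apply: eq_bigr => k _; rewrite mxE mulrDl.
Qed.

Definition berezin_solution g z : R[i] :=
  cexp (bdot z one) * conjc (g (z - one)).

Lemma measurable_berezin_solution g : measurable_fun setT g ->
  measurable_fun setT (berezin_solution g).
Proof.
move=> mg; apply: measurable_complexM.
  by apply: (measurableT_comp (@measurable_cexp R)); exact: measurable_bdot.
apply: (measurableT_comp (@measurable_conjc R)); apply: (measurableT_comp mg).
by case: (measure_preserving_Cn_translation (- one)).
Qed.

Lemma berezin_solution_integrable_form b g z : Sym g -> lC.-integrable setT
  (fun w => (cpart b (berezin_solution g w) * expR (2 * rdot w z) * dens w)%:E).
Proof.
move=> Sg; have [mg _] := Sg.
(* The shift by half of [one] accounts for the modulus [exp (rdot w one)] of the exponential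
   factor. *)
apply: (@Sym_integrable _ _ g (- one) (z + (2^-1)%:C *: one) _ Sg).
  apply: measurable_funM; last exact: measurable_gaussian_density.
  apply: measurable_funM.
    apply: (measurableT_comp (measurable_cpart b)).
    exact: measurable_berezin_solution.
  apply: measurableT_comp => //.
  by apply: measurable_funM => //; exact: measurable_rdot.
move=> w; rewrite 2!normrM (ger0_norm (expR_ge0 _)).
rewrite (ger0_norm (gaussian_density_ge0 w)).
apply: (@le_trans _ _ (normc (berezin_solution g w) * expR (2 * rdot w z) *
  expR (- normsq w))).
  apply: ler_pM.
  - by rewrite mulr_ge0 ?expR_ge0 ?normr_ge0.
  - exact: gaussian_density_ge0.
  - by rewrite ler_wpM2r ?expR_ge0 ?cpart_le.
  - exact: gaussian_density_le.
have normcJ (x : R[i]) : normc (conjc x) = normc x.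
  by case: x => x y; rewrite /= sqrrN.
rewrite /berezin_solution Normc.normcM normcJ normc_cexp Re_bdot_one.
rewrite mulrAC -!mulrA mulrCA ler_wpM2l ?normc_ge0// -!expRD ler_expR.
by rewrite rdotDr rdotZr mulrDr mulVKf ?pnatr_eq0//; lra.
Qed.

(* Completing the square after the translation [w = xi + (one + z)] turns the
   Berezin integral into a Gaussian mean of an (anti)entire function. *)
Lemma berezin_solution_integral b g z : entire g -> Sym g ->
  (\int[lC]_w (cpart b (berezin_solution g w) *
      expR (2 * rdot w z - normsq z) * dens w)%:E =
   (cpart b (cexp (bdot z one) * conjc (g z)))%:E)%E.
Proof.
move=> dg Sg; have [mg _] := Sg.
have mF : measurable_fun setT (fun w => cpart b (berezin_solution g w) *
      expR (2 * rdot w z - normsq z) * dens w).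
  apply: measurable_funM; last exact: measurable_gaussian_density.
  apply: measurable_funM.
    apply: (measurableT_comp (measurable_cpart b)).
    exact: measurable_berezin_solution.
  apply: measurableT_comp => //; apply: measurable_funB => //.
  by apply: measurable_funM => //; exact: measurable_rdot.
rewrite -(measure_preserving_integral
  (measure_preserving_Cn_translation (one + z)) mF).
set K := cexp (bdot z one); have [k kE] := cpart_conjcE b K.
pose H xi := k * (g (xi + z) * cexp (- bdot xi one)).
have HE xi : cpart b (berezin_solution g (xi + (one + z))) *
    expR (2 * rdot (xi + (one + z)) z - normsq z) * dens (xi + (one + z)) =
    complex.Re (H xi) * dens xi.
  rewrite /H -kE /gaussian_density 2!(mulrCA _ (pi ^- n)); congr (_ * _).
  rewrite -[LHS]mulrA -expRD -!cpartMr; congr (cpart b _).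
  have -> : conjc (g (xi + z) * cexp (- bdot xi one)) =
      conjc (g (xi + z)) * cexp (conjc (- bdot xi one)).
    by rewrite (rmorphM (@conjc R)); congr (_ * _); exact: conjc_cexp.
  rewrite /berezin_solution addrA.
  have -> : xi + one + z - one = xi + z by rewrite addrAC addrK.
  rewrite -!cexp_real.
  (* Translating by [z] centers the Gaussian. The further [one] contributes [- 2 Re (xi . one)], and
     [p - 2 Re p = - conjc p] turns the holomorphic exponent into an antiholomorphic one, matching
     the conjugate of [g]. *)
  have EE : bdot (xi + one + z) one +
      (2 * rdot (xi + one + z) z - normsq z + - normsq (xi + one + z))%:C =
      bdot z one + conjc (- bdot xi one) + (- normsq xi)%:C.
    have oo : bdot one one = (normsq one)%:C.
      by rewrite -bdot_conjv_norm conjv_one.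
    have zz : rdot z z = normsq z by [].
    rewrite !bdotDl oo.
    rewrite (normsqD (xi + one)) (normsqD xi) (rdotDl (xi + one)) zz -Re_bdot_one.
    case: (bdot xi one) => p q; case: (bdot z one) => p' q'.
    by apply/eqP; rewrite eq_complex /=; apply/andP; split; apply/eqP; ring.
  transitivity (cexp (bdot (xi + one + z) one +
     (2 * rdot (xi + one + z) z - normsq z + - normsq (xi + one + z))%:C) *
     conjc (g (xi + z))).
    by rewrite cexpD; ring.
  by rewrite EE /K !cexpD; ring.
under eq_integral do rewrite HE.
have mH : measurable_fun setT H.
  apply: measurable_complexM => //; apply: measurable_complexM.
    apply: (measurableT_comp mg).
    by case: (measure_preserving_Cn_translation z).
  rewrite (_ : (fun _ => _) = (fun xi => cexp (bdot xi (- one)))).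
    by apply: (measurableT_comp (@measurable_cexp R)); exact: measurable_bdot.
  apply/funext => xi; congr cexp; rewrite /bdot -sumrN.
  by apply: eq_bigr => i _; rewrite !mxE mulrN.
have H0 : H 0 = k * g z.
  rewrite /H add0r (_ : bdot 0 one = 0) ?oppr0 ?cexp0 ?mulr1//.
  by rewrite /bdot big1// => i _; rewrite mxE mul0r.
rewrite gaussian_mean_value//.
- by rewrite H0 -kE.
- move=> xi; apply: differentiableM; first exact: differentiable_cst.
  apply: differentiableM.
    exact: (@differentiable_comp _ _ _ _ (fun xi => xi + z) g).
  apply: (@differentiable_comp _ _ _ _ (fun xi => - bdot xi one) (@cexp R)).
    by apply: differentiableN; exact: differentiable_bdot.
  exact: differentiable_cexp.
(* [Sym_integrable] has no constant in its bound, so the modulus of [k] is divided out; if [k = 0]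
   the integrand vanishes. *)
- pose c := normc k.
  have -> : (fun xi => (complex.Re (H xi) * dens xi)%:E) =
      (fun xi => (c * (c^-1 * (complex.Re (H xi) * dens xi)))%:E).
    apply/funext => xi; congr EFin; have [c0|c0] := eqVneq c 0; last first.
      by rewrite mulVKf.
    by rewrite c0 mul0r /H (Normc.eq0_normc c0) !mul0r.
  under eq_fun do rewrite EFinM.
  apply: integrableZl => //.
  apply: (@Sym_integrable _ _ g z ((- 2^-1)%:C *: one) _ Sg).
    apply: measurable_funM => //; apply: measurable_funM; last exact: measurable_gaussian_density.
    exact: (measurableT_comp (@measurable_Re R)).
  move=> xi.
  have [c0|c0] := eqVneq c 0.
    by rewrite c0 invr0 mul0r normr0 mulr_ge0 ?normc_ge0 ?expR_ge0.
  have cgt0 : 0 < c by rewrite lt_def c0 normc_ge0.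
  have ci0 : 0 <= c^-1 by rewrite invr_ge0 ltW.
  rewrite normrM (ger0_norm ci0) ler_pdivrMl// normrM.
  rewrite (ger0_norm (gaussian_density_ge0 xi)) expRD.
  have hH : `|complex.Re (H xi)| <=
      c * (normc (g (xi + z)) * expR (2 * rdot xi ((- 2^-1)%:C *: one))).
    apply: (le_trans (normc_Re_le _)); rewrite /H 2!Normc.normcM normc_cexp.
    have -> : 2 * rdot xi ((- 2^-1)%:C *: one) = - rdot xi one.
      by rewrite rdotZr; field.
    have ReN (x : R[i]) : complex.Re (- x) = - complex.Re x by case: x.
    by rewrite ReN Re_bdot_one.
  rewrite (mulrA (normc (g _))) [leRHS]mulrA; apply: ler_pM => //.
    exact: gaussian_density_ge0.
  exact: gaussian_density_le.
Qed.

(** [u] and the explicit solution have the same Berezin transform, so each part of their difference,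
    times the Gaussian density, is annihilated by all exponentials. *)
Lemma berezin_equation_unique g u : entire g -> Sym g ->
  cLp (@gaussian_measure R n) 2%:E u ->
  (forall z, berezin u z = cexp (bdot z one) * conjc (g z)) ->
  {ae lC, forall z, u z = berezin_solution g z}.
Proof.
move=> dg Sg u2 u_sol; have [mg _] := Sg; have [mu _] := u2.
have mu0 := measurable_berezin_solution mg.
have cpart_ae b : {ae lC, forall w, cpart b (u w) = cpart b (berezin_solution g w)}.
  pose h w := (cpart b (u w) - cpart b (berezin_solution g w)) * dens w.
  have mh : measurable_fun setT h.
    apply: measurable_funM; last exact: measurable_gaussian_density.
    by apply: measurable_funB; exact: (measurableT_comp (measurable_cpart b)).
  have hE L w : h w * expR L = cpart b (u w) * expR L * dens w -
      cpart b (berezin_solution g w) * expR L * dens w.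
    by rewrite /h; ring.
  have ann : exp_annihilated lC (@rdot_forms R n) h.
    split => // _ [z ->].
    have iu := L2_integrable_form b z u2.
    have iu0 := berezin_solution_integrable_form b z Sg.
    under eq_fun do rewrite hE EFinB.
    split; first exact: integrableB.
    rewrite integralB//.
    (* The factor [exp (- |z|^2)] of the squared kernel is constant in [w] and comes out of the
       integral. *)
    have shift (v : 'rV[R[i]]_n -> R[i]) :
      lC.-integrable setT (fun w => (cpart b (v w) * expR (2 * rdot w z) * dens w)%:E) ->
      (\int[lC]_w (cpart b (v w) * expR (2 * rdot w z) * dens w)%:E =
      (expR (normsq z))%:E *
      \int[lC]_w (cpart b (v w) * expR (2 * rdot w z - normsq z) * dens w)%:E)%E.
      move=> iv.
      have -> : (fun w => (cpart b (v w) * expR (2 * rdot w z - normsq z) * dens w)%:E) =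
          (fun w => (expR (- normsq z))%:E *
            (cpart b (v w) * expR (2 * rdot w z) * dens w)%:E)%E.
        by apply/funext => w; rewrite -EFinM expRD; congr EFin; ring.
      by rewrite integralZl// muleA -EFinM -expRD subrr expR0 mul1e.
    (* The Berezin transform is read through [fine], which determines the integral only when it is
       finite. *)
    have fu : (\int[lC]_w (cpart b (u w) * expR (2 * rdot w z - normsq z) * dens w)%:E)%E
        \is a fin_num.
      have -> : (fun w => (cpart b (u w) * expR (2 * rdot w z - normsq z) * dens w)%:E) =
          (fun w => (expR (- normsq z))%:E *
            (cpart b (u w) * expR (2 * rdot w z) * dens w)%:E)%E.
        by apply/funext => w; rewrite -EFinM expRD; congr EFin; ring.
      by apply: integrable_fin_num => //; exact: integrableZl.
    rewrite !shift// (berezin_solution_integral b z dg Sg) -u_sol berezinE// fineK//.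
    by rewrite subee// fin_numM.
  have h0 : ae_eq lC setT (EFin \o h) (cst 0%E).
    apply: (exp_annihilated_ae0 (Lin := @rdot_forms R n)) => //.
    - by move=> _ [z ->]; apply: measurable_funM => //; exact: measurable_rdot.
    - move=> _ _ [z ->] [z' ->]; exists (z + z').
      by apply/funext => w /=; rewrite rdotDr mulrDr.
    - move=> a _ [z ->]; exists (a%:C *: z).
      by apply/funext => w; rewrite rdotZr mulrCA.
    - by exists (fun w => 2 * rdot w 0), 0.
    - exact: measurable_Cn_rdot_forms.
  apply: filterS h0 => w /(_ I) /= [] /eqP.
  by rewrite /h mulf_eq0 (gt_eqF (gaussian_density_gt0 w)) orbF subr_eq0 => /eqP.
apply: filterS2 (cpart_ae true) (cpart_ae false) => w re im; apply/eqP; rewrite eq_complex.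
by apply/andP; split; apply/eqP.
Qed.

End berezin_equation.

Theorem proposition9 (R : realType) (n : nat) (n_ge1 : (1 <= n)%N)
    (g : 'rV[R[i]]_n -> R[i]) (g_entire : entire g) (g_Sym : Sym g)
    (u : 'rV[R[i]]_n -> R[i]) (u_L2 : cLp (@gaussian_measure R n) 2%:E u)
    (u_sol : forall z : 'rV[R[i]]_n,
      berezin u z = cexp (bdot z (const_mx 1)) * conjc (g z)) :
  {ae lebesgue_Cn R n, forall z : 'rV[R[i]]_n,
    u z = cexp (bdot z (const_mx 1)) * conjc (g (z - const_mx 1))}.
Proof. exact: berezin_equation_unique g_entire g_Sym u_L2 u_sol. Qed.
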